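(* Let $(\mathrm{RAN}_t)_{t\ge 0}$ be the random Apollonian network process, let $\mathcal{L}_t$ be the number of vertices in a longest (simple) path in $\mathrm{RAN}_t$, and let $\delta = 1-4\times 10^{-8}$. Then $\mathcal{L}_t<t^{\delta}$ eventually (for large $t$).
   Context: Random Apollonian network: start with a triangle embedded in the plane. At each step, choose a bounded face uniformly at random (given the past), add a new vertex inside that face and join it to the three vertices on the face; in this way one face is destroyed and three new bounded faces are created. After $t$ steps one obtains a random triangulated plane graph $\mathrm{RAN}_t$ with $t+3$ vertices, $3t+3$ edges, $2t+1$ bounded faces and one unbounded face. A sequence of events $\{A_k, k\in\mathbb{N}\}$ occurs eventually (for large $k$) if there exists an almost surely finite random variable $N$ such that $A_k$ occurs for all $k\ge N$. *)

(* Defs.v *)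
(* MathComp / MathComp-Analysis *)
From mathcomp Require Import all_boot all_order all_algebra.
From mathcomp Require Import all_classical all_reals all_analysis.
From mathcomp Require Import measurable_realfun.

Set Implicit Arguments.
Unset Strict Implicit.
Unset Printing Implicit Defensive.

Import Order.TTheory GRing.Theory Num.Theory.
Import numFieldNormedType.Exports.

Local Open Scope classical_set_scope.
Local Open Scope ring_scope.

(* A bounded face is the cyclic sequence of its three corners, in
   counterclockwise order, so that the list of bounded faces also records the
   plane embedding. *)
Definition face : Type := (nat * nat * nat)%type.

(* The vertices are 0, ..., nvert - 1, in order of insertion. Each undirected
   edge is listed once, in one of its two orientations. The unbounded face
   always has boundary 0, 1, 2 and is not listed. *)
Record plane_graph := PlaneGraph {
  nvert : nat;
  edges : seq (nat * nat);
  bfaces : seq face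
}.

Definition triangle : plane_graph :=
  PlaneGraph 3 [:: (0, 1); (1, 2); (2, 0)]%N [:: (0, 1, 2)%N].

Definition insert_vertex (G : plane_graph) (f : face) : plane_graph :=
  let: (a, b, c) := f in
  let v := nvert G in
  PlaneGraph v.+1
    [:: (a, v), (b, v), (c, v) & edges G]
    [:: (a, b, v), (b, c, v), (c, a, v) & rem f (bfaces G)].

(* The network after t steps, when c s is the face subdivided at step s + 1. *)
Fixpoint ran (c : nat -> face) (t : nat) : plane_graph :=
  if t is s.+1 then insert_vertex (ran c s) (c s) else triangle.

(* F s is the random face subdivided at step s + 1. The choices before step
   t + 1 carry the same information as the networks up to time t, and the last
   clause says that, given those choices, the next one is uniform on the
   bounded faces of the current network; multiplying out the conditional
   probability covers pasts of probability zero. *)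
Definition uniform_face_choices (R : realType) (d : measure_display)
    (T : measurableType d) (P : probability T R) (F : nat -> T -> face) : Prop :=
  (forall t, measurable_fun setT (F t)) /\
  (forall (t : nat) (c : nat -> face) (f : face), f \in bfaces (ran c t) ->
    let past := [set w | forall s, (s < t)%N -> F s w = c s] in
    P (past `&` [set w | F t w = f]) =
      (((size (bfaces (ran c t)))%:R^-1)%:E * P past)%E).

Definition RAN (T : Type) (F : nat -> T -> face) (t : nat) (w : T) :
  plane_graph := ran (F^~ w) t.

Definition adj (G : plane_graph) : rel nat :=
  fun i j => ((i, j) \in edges G) || ((j, i) \in edges G).

(* The number of vertices in a longest simple path. *)
Definition longest_path (G : plane_graph) : nat :=
  \max_(k < (nvert G).+1 |
        [exists p : k.-tuple 'I_(nvert G),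
           uniq p && sorted (fun i j : 'I_(nvert G) => adj G i j) p]) k.

Definition occurs_eventually (R : realType) (d : measure_display)
    (T : measurableType d) (P : probability T R) (A : nat -> set T) : Prop :=
  exists N : T -> \bar R,
    [/\ measurable_fun setT N,
        {ae P, forall w, N w \is a fin_num} &
        forall (w : T) (k : nat), (N w <= k%:R%:E)%E -> A k w].

(* Main.v *)
Require Import Defs.
From HB Require Import structures.
From mathcomp Require Import all_boot all_order all_algebra.
From mathcomp Require Import all_classical all_reals all_analysis.
From mathcomp Require Import measurable_realfun.
From mathcomp Require Import ring lra zify.

Set Implicit Arguments.
Unset Strict Implicit.
Unset Printing Implicit Defensive.

Import Order.TTheory GRing.Theory Num.Theory.
Import numFieldNormedType.Exports.

Local Open Scope classical_set_scope.
Local Open Scope ring_scope.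

(** Each inserted vertex splits a bounded face into three, so the network is
recorded by a ternary tree: its leaves are the bounded faces, its internal
nodes the inserted vertices.

Paths. Take a face whose three children are all subdivided. Its three corners,
the vertex inserted in it and the three vertices inserted in its children are
seven vertices that separate the interiors of its nine grandchildren from each
other and from the rest of the graph. A simple path meets these vertices at
most seven times, hence has at most eight excursions and misses one of the nine
interiors ([missed_grandchild]). Iterating over k pairs of generations, a path
has fewer than 3 + 9^k + kept k x vertices ([longest_path_kept]), where [kept]
adds up the faces of the subtrees below depth 2k after dropping, from the
bottom up, the least of the nine grandchildren.

Mean of [kept]. The tree after n steps is uniform over growth histories, and
given their sizes the three subtrees of the root are independent trees of the
same kind ([mean_resample]). By induction on k, for every n the mean of
[kept k] is at most L s and its second moment at most (19/18) L^2 s^2, where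
s = 2n + 1 is the number of faces and L = (1 - 10^-6)^k. The second moment
propagates since the sum of the squares of the children weights is on average
at most (3/5) s^2 ([mean_children_sqr]). For the first moment, let X_j be the
total of the j-th grandchild divided by L times its weight. From
min X >= 1/2 - (1/2) sum (1 - X_j)^2, an inequality that involves only first
and second moments, the mean loss is at least about L/4 times the mean of a
product of weights which bounds the least grandchild weight from below
([thin_dev], [mean_kids_dev]). A grandchild whose mean falls short of the
inductive bound makes the minimum smaller, but it makes the sum smaller by at
least as much: the coefficient of each first moment stays nonnegative.
The mean of the product is an exact moment of a Polya urn
([mean_children_prod]), so that one stage gains at least a factor 1 - 10^-6
([mean_thin]).

Conclusion. At time 81^(k+1), with k stages, 9^k is negligible against
81^(k delta), and Markov's inequality bounds the probability of a path with
81^(k delta) vertices by a geometric sequence in k, because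
(1 - 10^-6) 81^(1 - delta) < 1 ([ratio_lt1]). Borel-Cantelli gives the bound at
these times, and it extends to the others because the longest path grows with
the network ([longest_path_ran]). *)

(** * Averages over finite sequences *)

Section Average.
Variables (R : realFieldType) (X : Type).
Implicit Types (s : seq X) (g h : X -> R).

Definition avg s h : R := (\sum_(x <- s) h x) / (size s)%:R.

Lemma avgD s g h : avg s (fun x => g x + h x) = avg s g + avg s h.
Proof. by rewrite /avg big_split mulrDl. Qed.

Lemma avgZ s c h : avg s (fun x => c * h x) = c * avg s h.
Proof. by rewrite /avg -mulr_sumr mulrA. Qed.

Lemma avg_cst s c : (0 < size s)%N -> avg s (fun=> c) = c.
Proof.
move=> s_gt0; rewrite /avg big_const_seq count_predT iter_addr_0 -[c *+ _]mulr_natr.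
by rewrite mulfK // pnatr_eq0 -lt0n.
Qed.

Lemma avg_le (p : pred X) s g h :
  all p s -> (forall x, p x -> g x <= h x) -> avg s g <= avg s h.
Proof.
move=> ps gh; rewrite /avg ler_wpM2r ?invr_ge0 ?ler0n //.
elim: s ps => [|x s IHs]; first by rewrite !big_nil.
by rewrite /= => /andP[px ps]; rewrite !big_cons lerD ?gh ?IHs.
Qed.

Lemma avg_eq (p : pred X) s g h :
  all p s -> (forall x, p x -> g x = h x) -> avg s g = avg s h.
Proof.
by move=> ps gh; apply: le_anti; rewrite !(avg_le ps) // => x /gh->.
Qed.

Lemma avg_flatten m (f : X -> seq X) s h :
  all (fun x => size (f x) == m) s ->
  avg (flatten [seq f x | x <- s]) h = avg s (fun x => avg (f x) h).
Proof.
move=> fm; have szf : size (flatten [seq f x | x <- s]) = (size s * m)%N.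
  elim: s fm => //= x s IHs /andP[/eqP fx /IHs].
  by rewrite size_cat fx mulSn => ->.
transitivity (avg s (fun x => m%:R^-1 * \sum_(y <- f x) h y)).
  by rewrite avgZ /avg szf big_flatten /= big_map natrM invfM; ring.
by apply: (avg_eq fm) => x /eqP fx; rewrite [RHS]/avg fx mulrC.
Qed.

End Average.

Lemma avg_exchange (R : realFieldType) (X Y : Type) (s : seq X) (t : seq Y)
    (h : X -> Y -> R) :
  avg s (fun x => avg t (h x)) = avg t (fun y => avg s (h^~ y)).
Proof. by rewrite /avg -!mulr_suml exchange_big mulrAC. Qed.

(** * Random ternary trees *)
Inductive shape := leaf | node of shape & shape & shape.

Fixpoint vol (x : shape) : nat :=
  if x is node a b c then (vol a + vol b + vol c).+1 else 0%N.

(** The leaves are listed from left to right, so that an entry of this sequence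
is the subdivision of the leaf of the same rank. *)
Fixpoint growths (x : shape) : seq shape :=
  if x is node a b c then
    [seq node a' b c | a' <- growths a] ++
    [seq node a b' c | b' <- growths b] ++
    [seq node a b c' | c' <- growths c]
  else [:: node leaf leaf leaf].

Lemma size_growths x : size (growths x) = (2 * vol x).+1.
Proof.
elim: x => //= a IHa b IHb c IHc.
by rewrite !size_cat !size_map IHa IHb IHc; lia.
Qed.

Lemma vol_growths x : all (fun y => vol y == (vol x).+1) (growths x).
Proof.
elim: x => //= a IHa b IHb c IHc; rewrite !all_cat !all_map; apply/and3P; split.
- by apply: sub_all IHa => y /= /eqP->; rewrite !addSn.
- by apply: sub_all IHb => y /= /eqP->; rewrite !addnS !addSn.
- by apply: sub_all IHc => y /= /eqP->; rewrite !addnS.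
Qed.

(** A tree occurs once for each order in which its internal nodes can have been
created; the uniform average over this sequence is the law of the tree. *)
Fixpoint histories (n : nat) : seq shape :=
  if n is m.+1 then flatten [seq growths x | x <- histories m] else [:: leaf].

Lemma vol_histories n : all (fun x => vol x == n) (histories n).
Proof.
elim: n => //= n; elim: (histories n) => //= x s IHs /andP[/eqP xn /IHs].
by rewrite all_cat => ->; rewrite andbT -xn vol_growths.
Qed.

Lemma histories_gt0 n : (0 < size (histories n))%N.
Proof.
elim: n => //= n; have := vol_histories n.
by case: (histories n) => //= x s _ _; rewrite size_cat size_growths.
Qed.

Section Expectation.
Variable R : realFieldType.
Implicit Types (g h : shape -> R) (n : nat) (x y z : shape).

Definition step h x : R := avg (growths x) h.
Definition mean n h : R := avg (histories n) h.

Lemma mean0 h : mean 0 h = h leaf.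
Proof. by rewrite /mean /avg big_seq1 divr1. Qed.

Lemma meanS n h : mean n.+1 h = mean n (step h).
Proof.
rewrite /mean /= (@avg_flatten _ _ (2 * n).+1) //.
by apply: sub_all (vol_histories n) => x /eqP <-; rewrite size_growths.
Qed.

Lemma mean_iter n h : mean n h = iter n step h leaf.
Proof. by elim: n h => [|n IHn] h; rewrite ?mean0 // meanS IHn iterSr. Qed.

Lemma meanD n g h : mean n (fun x => g x + h x) = mean n g + mean n h.
Proof. exact: avgD. Qed.

Lemma meanZ n c h : mean n (fun x => c * h x) = c * mean n h.
Proof. exact: avgZ. Qed.

Lemma mean_cst n c : mean n (fun=> c) = c.
Proof. exact: avg_cst (histories_gt0 n). Qed.

Lemma le_mean n g h :
  (forall x, vol x = n -> g x <= h x) -> mean n g <= mean n h.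
Proof. by move=> gh; apply: (avg_le (vol_histories n)) => x /eqP/gh. Qed.

Lemma eq_mean n g h :
  (forall x, vol x = n -> g x = h x) -> mean n g = mean n h.
Proof. by move=> gh; apply: (avg_eq (vol_histories n)) => x /eqP/gh. Qed.

(** The number of leaves. Unlike the number of internal nodes it is exactly
additive over the children, and a leaf has weight 1. *)
Definition weight x : R := (2 * vol x).+1%:R.

Lemma weight_gt0 x : 0 < weight x.
Proof. by rewrite ltr0n. Qed.

Lemma weight_node x y z : weight (node x y z) = weight x + weight y + weight z.
Proof. by rewrite /weight -!natrD; congr _%:R; rewrite /=; lia. Qed.

Lemma step_node h x y z :
  step h (node x y z) =
    (weight x * step (fun x' => h (node x' y z)) x +
     weight y * step (fun y' => h (node x y' z)) y +
     weight z * step (fun z' => h (node x y z')) z) / weight (node x y z).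
Proof.
have avgE (f : shape -> R) t :
    weight t * step f t = \sum_(u <- growths t) f u.
  by rewrite /step /avg size_growths mulrC divfK // pnatr_eq0.
rewrite !avgE /step /avg size_growths; congr (_ / _).
by rewrite /= !big_cat /= !big_map addrA.
Qed.


Definition mean3 i j k (h : shape -> shape -> shape -> R) : R :=
  mean i (fun a => mean j (fun b => mean k (h a b))).

Lemma mean3D i j k (g h : shape -> shape -> shape -> R) :
  mean3 i j k (fun a b c => g a b c + h a b c) = mean3 i j k g + mean3 i j k h.
Proof.
rewrite -meanD; apply: eq_mean => a _; rewrite -meanD.
by apply: eq_mean => b _; rewrite -meanD.
Qed.

Lemma mean3Z i j k u (h : shape -> shape -> shape -> R) :
  mean3 i j k (fun a b c => u * h a b c) = u * mean3 i j k h.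
Proof.
rewrite -meanZ; apply: eq_mean => a _; rewrite -meanZ.
by apply: eq_mean => b _; rewrite -meanZ.
Qed.

Lemma le_mean3 i j k (g h : shape -> shape -> shape -> R) :
  (forall a b c, vol a = i -> vol b = j -> vol c = k -> g a b c <= h a b c) ->
  mean3 i j k g <= mean3 i j k h.
Proof.
move=> gh; apply: le_mean => a va; apply: le_mean => b vb.
by apply: le_mean => c vc; apply: gh.
Qed.

Lemma eq_mean3 i j k (g h : shape -> shape -> shape -> R) :
  (forall a b c, vol a = i -> vol b = j -> vol c = k -> g a b c = h a b c) ->
  mean3 i j k g = mean3 i j k h.
Proof.
by move=> gh; apply: le_anti; rewrite !le_mean3 // => a b c va vb vc; rewrite gh.
Qed.

Lemma mean3M i j k (f g h : shape -> R) :
  mean3 i j k (fun a b c => f a * g b * h c) = mean i f * mean j g * mean k h.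
Proof.
transitivity (mean i (fun a => mean j g * mean k h * f a)); last first.
  by rewrite meanZ mulrC mulrA.
apply: eq_mean => a _.
transitivity (mean j (fun b => f a * mean k h * g b)); last first.
  by rewrite meanZ; ring.
by apply: eq_mean => b _; rewrite meanZ; ring.
Qed.

(** Growing one of three independent trees by one step advances its own clock
only. *)
Lemma mean3S1 i j k (h : shape -> shape -> shape -> R) :
  mean3 i j k (fun a b c => step (fun a' => h a' b c) a) = mean3 i.+1 j k h.
Proof.
rewrite /mean3 meanS; apply: eq_mean => a _; rewrite [RHS]avg_exchange.
by apply: eq_mean => b _; exact: avg_exchange.
Qed.

Lemma mean3S2 i j k (h : shape -> shape -> shape -> R) :
  mean3 i j k (fun a b c => step (fun b' => h a b' c) b) = mean3 i j.+1 k h.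
Proof.
apply: eq_mean => a _; rewrite meanS; apply: eq_mean => b _.
exact: avg_exchange.
Qed.

Lemma mean3S3 i j k (h : shape -> shape -> shape -> R) :
  mean3 i j k (fun a b c => step (h a b) c) = mean3 i j k.+1 h.
Proof. by apply: eq_mean => a _; apply: eq_mean => b _; rewrite meanS. Qed.

(** The conditional expectation given the sizes of the three subtrees of the
root, if these subtrees are independent. *)
Definition resample h x : R :=
  if x is node a b c then
    mean3 (vol a) (vol b) (vol c) (fun a' b' c' => h (node a' b' c'))
  else h leaf.

Lemma step_cst u h x : (forall y, vol y = (vol x).+1 -> h y = u) -> step h x = u.
Proof.
move=> hu; rewrite /step (avg_eq (vol_growths x) (h := fun=> u)).
  by rewrite avg_cst // size_growths.
by move=> y /eqP/hu.
Qed.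

(** The leaf to be subdivided lies in a given subtree with probability
proportional to its weight and is then uniform in that subtree; this rule sees
only the sizes and therefore commutes with resampling. *)
Lemma resample_step h x y z :
  resample (step h) (node x y z) = step (resample h) (node x y z).
Proof.
pose H a b c := h (node a b c); set W := (weight (node x y z))^-1.
transitivity (mean3 (vol x) (vol y) (vol z) (fun a b c =>
    W * weight x * step (fun a' => H a' b c) a +
    W * weight y * step (fun b' => H a b' c) b +
    W * weight z * step (H a b) c)).
  apply: eq_mean3 => a b c va vb vc.
  rewrite step_node /W /weight /= va vb vc -/(weight (node x y z)) /H.
  ring.
rewrite !mean3D !mean3Z mean3S1 mean3S2 mean3S3 step_node -/W.
rewrite (step_cst (u := mean3 (vol x).+1 (vol y) (vol z) H)) => [|t /= -> //].
rewrite (step_cst (u := mean3 (vol x) (vol y).+1 (vol z) H)) => [|t /= -> //].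
rewrite (step_cst (u := mean3 (vol x) (vol y) (vol z).+1 H)) => [|t /= -> //].
ring.
Qed.

(** Given their sizes, the subtrees of the root are independent trees of the
same kind. *)
Lemma mean_resample n h : mean n (resample h) = mean n h.
Proof.
case: n => [|n]; first by rewrite !mean0.
elim: n h => [|n IHn] h.
  by rewrite !meanS !mean0 /step /avg !big_seq1 /= /mean3 !mean0.
rewrite [RHS]meanS -IHn [LHS]meanS; apply: eq_mean => -[//|x y z] _.
by rewrite resample_step.
Qed.

Definition on_children (f : R -> R -> R -> R) x : R :=
  if x is node a b c then f (weight a) (weight b) (weight c) else 0.

(** The weights of the three children of the root follow a Polya urn with one
ball of each colour at the start and two balls added at each draw. *)
Lemma step_on_children f x y z :
  step (on_children f) (node x y z) =
    (weight x * f (weight x + 2) (weight y) (weight z) +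
     weight y * f (weight x) (weight y + 2) (weight z) +
     weight z * f (weight x) (weight y) (weight z + 2)) / weight (node x y z).
Proof.
have w2 u v : vol u = (vol v).+1 -> weight u = weight v + 2.
  by rewrite /weight => ->; rewrite -natrD; congr _%:R; lia.
rewrite step_node; congr ((_ * _ + _ * _ + _ * _) / _).
- by apply: step_cst => t /w2 wt; rewrite /on_children wt.
- by apply: step_cst => t /w2 wt; rewrite /on_children wt.
- by apply: step_cst => t /w2 wt; rewrite /on_children wt.
Qed.

Definition size_weight n : R := (2 * n).+1%:R.

Lemma size_weightS n : size_weight n.+1 = size_weight n + 2.
Proof. by rewrite /size_weight -natrD; congr _%:R; lia. Qed.

Lemma size_weight_ge1 n : 1 <= size_weight n.
Proof. by rewrite ler1n. Qed.

(** One draw of the urn multiplies the mean of the product by (s + 6) / s. *)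
Lemma mean_children_prod n :
  mean n.+1 (on_children (fun u v w => u * v * w)) =
    size_weight n.+1 * (size_weight n.+1 + 2) * (size_weight n.+1 + 4) / 105.
Proof.
elim: n => [|n IHn].
  by rewrite meanS mean0 /step /avg big_seq1 /size_weight /= /weight /=; field.
rewrite meanS size_weightS; set s := size_weight n.+1.
have s1 : 1 <= s := size_weight_ge1 _.
transitivity (mean n.+1 (fun x =>
    (s + 6) / s * on_children (fun u v w => u * v * w) x)).
  apply: eq_mean => -[//|x y z] vxyz; rewrite step_on_children /=.
  have -> : weight (node x y z) = s by rewrite /weight vxyz.
  have -> : s = weight x + weight y + weight z.
    by rewrite -weight_node /weight vxyz.
  have := weight_gt0 x; have := weight_gt0 y; have := weight_gt0 z.
  move=> *; field; lra.
rewrite meanZ IHn -/s; field; lra.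
Qed.

(** One draw of the urn multiplies the mean of u (u + 2) by (s + 4) / s; the
mean of u is s / 3. *)
Lemma mean_children_sqr n :
  mean n.+1 (on_children (fun u v w => u ^+ 2 + v ^+ 2 + w ^+ 2)) <=
    3 / 5 * size_weight n.+1 ^+ 2.
Proof.
pose q u v w : R := u * (u + 2) + v * (v + 2) + w * (w + 2).
have qE : mean n.+1 (on_children q) =
    3 / 5 * (size_weight n.+1 * (size_weight n.+1 + 2)).
  elim: n => [|n IHn].
    by rewrite meanS mean0 /step /avg big_seq1 /size_weight /= /weight /q /=; field.
  rewrite meanS size_weightS; set s := size_weight n.+1.
  have s1 : 1 <= s := size_weight_ge1 _.
  transitivity (mean n.+1 (fun x => (s + 4) / s * on_children q x)).
    apply: eq_mean => -[//|x y z] vxyz; rewrite step_on_children /= /q.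
    have -> : weight (node x y z) = s by rewrite /weight vxyz.
    have -> : s = weight x + weight y + weight z.
      by rewrite -weight_node /weight vxyz.
    have := weight_gt0 x; have := weight_gt0 y; have := weight_gt0 z.
    move=> *; field; lra.
  rewrite meanZ IHn -/s; field; lra.
set s := size_weight n.+1 in qE *; have s1 : 1 <= s := size_weight_ge1 _.
have -> : 3 / 5 * s ^+ 2 = mean n.+1 (on_children q) + - (6 / 5 * s).
  by rewrite qE; ring.
rewrite -[X in _ + X](mean_cst n.+1) -meanD; apply: le_mean => -[//|x y z] vxyz.
have sE : s = weight x + weight y + weight z.
  by rewrite -weight_node /weight vxyz.
rewrite /q /=.
have := weight_gt0 x; have := weight_gt0 y; have := weight_gt0 z.
move=> *; nra.
Qed.

End Expectation.

(** * Keeping eight grandchildren out of nine *)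
Section Thinning.
Implicit Types (V : shape -> nat) (x y z a b c : shape).
Local Open Scope nat_scope.

Definition kids_sum V x :=
  if x is node a b c then V a + V b + V c else 0.

Definition kids_min V x :=
  if x is node a b c then minn (V a) (minn (V b) (V c)) else 0.

(** The total over the grandchildren minus the least one. A missing grandchild
counts 0, and then nothing is subtracted. *)
Definition thin V x :=
  if x is node a b c then
    kids_sum V a + kids_sum V b + kids_sum V c -
    minn (kids_min V a) (minn (kids_min V b) (kids_min V c))
  else 0.

(** Stage 0 counts faces instead of vertices because the number of faces is
exactly additive over the children. *)
Definition kept k : shape -> nat := iter k thin (fun x => (2 * vol x).+1).

End Thinning.

(** * One stage multiplies the mean by at most 1 - 10^-6 *)
Section Moments.
Variable R : realFieldType.
Implicit Types (f g h : shape -> R) (n : nat) (x y z a b c : shape).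

Local Notation s_ n := (size_weight R n).
Local Notation w x := (weight R x).

Lemma mean3_sum i j k f g h :
  mean3 i j k (fun a b c => f a + g b + h c) = mean i f + mean j g + mean k h.
Proof.
pose one : shape -> R := fun=> 1.
transitivity (mean3 i j k (fun a b c => f a * one b * one c) +
              mean3 i j k (fun a b c => one a * g b * one c) +
              mean3 i j k (fun a b c => one a * one b * h c)).
  by rewrite -!mean3D; apply: eq_mean3 => a b c _ _ _; rewrite /one; ring.
by rewrite !mean3M /one !mean_cst; ring.
Qed.

Lemma weight_vol x : w x = s_ (vol x).
Proof. by []. Qed.

Lemma weight_ge1 x : 1 <= w x.
Proof. exact: size_weight_ge1. Qed.

(** A substitute for the least child weight that is a polynomial in the children
weights once the total weight is fixed, so that its mean is an exact moment of
the urn. The value at a leaf makes the lower bound w / 105 of the mean hold for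
a single leaf as well. *)
Definition spread x : R :=
  if x is node a b c then w a * w b * w c / w x ^+ 2 else 105^-1.

Lemma spread_gt0 x : 0 < spread x.
Proof.
case: x => [|a b c] /=; first by rewrite invr_gt0 ltr0n.
by rewrite divr_gt0 ?exprn_gt0 ?mulr_gt0 ?weight_gt0.
Qed.

Lemma spread_bound u v t : 0 < u -> 0 < v -> 0 < t ->
  u * v * t / (u + v + t) ^+ 2 <= t / 4 :> R.
Proof.
move=> u0 v0 t0; rewrite ler_pdivrMr; last by rewrite exprn_gt0 //; lra.
have := sqr_ge0 (u - v); have := mulr_gt0 u0 v0; have := mulr_gt0 t0 u0.
have := mulr_gt0 t0 v0; have := mulr_gt0 t0 t0 => *.
have : 4 * (u * v) <= (u + v + t) ^+ 2 by nra.
move=> ?; nra.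
Qed.

Lemma spread_le_kids a b c :
  [/\ spread (node a b c) <= w a / 4, spread (node a b c) <= w b / 4
    & spread (node a b c) <= w c / 4].
Proof.
rewrite /spread weight_node.
move: (weight_gt0 R a) (weight_gt0 R b) (weight_gt0 R c) => a0 b0 c0.
split; last exact: spread_bound.
- by rewrite -(mulrA (w a)) (mulrC (w a)) -addrA (addrC (w a)); exact: spread_bound.
- by rewrite (mulrAC (w a)) (addrAC (w a)); exact: spread_bound.
Qed.

Lemma spread_le x : spread x <= w x / 12.
Proof.
case: x => [|a b c]; first by rewrite /spread /weight /=; lra.
have [] := spread_le_kids a b c; rewrite weight_node; lra.
Qed.

Lemma mean_spread_le n : mean n spread <= s_ n / 12.
Proof.
rewrite -[leRHS](mean_cst n); apply: le_mean => x <-; exact: spread_le.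
Qed.

Lemma mean_spread_ge n : s_ n / 105 <= mean n spread.
Proof.
case: n => [|n]; first by rewrite mean0 /size_weight /=; lra.
rewrite (@eq_mean _ _ _ (fun x => (s_ n.+1 ^+ 2)^-1 *
  on_children (fun u v t => u * v * t) x)); last first.
  by move=> [//|a b c] vx; rewrite /= [RHS]mulrC /weight vx.
rewrite meanZ mean_children_prod.
have := size_weight_ge1 R n.+1; move: (s_ n.+1) => s s1.
rewrite [leRHS]mulrC ler_pdivlMr ?exprn_gt0; [|lra..].
rewrite -!mulrA; nra.
Qed.


Section Step.
(** The inductive step for an arbitrary functional [V] with the two moment bounds;
[S] is its total over the children of the root. *)
Variables (V : shape -> nat) (L : R).
Hypothesis L_gt0 : 0 < L.
Let f x : R := (V x)%:R.
Hypothesis mean_f : forall n, mean n f <= L * s_ n.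
Hypothesis mean_f2 : forall n,
  mean n (fun x => f x ^+ 2) <= 19 / 18 * L ^+ 2 * s_ n ^+ 2.

Let S x : R := (kids_sum V x)%:R.

Let f_ge0 x : 0 <= f x. Proof. exact: ler0n. Qed.
Let S_ge0 x : 0 <= S x. Proof. exact: ler0n. Qed.

Let SE a b c : S (node a b c) = f a + f b + f c.
Proof. by rewrite /S /= !natrD. Qed.

Lemma mean_kids n : mean n S <= L * s_ n.
Proof.
rewrite -mean_resample -[leRHS](mean_cst n); apply: le_mean => -[|a b c] vx.
  by rewrite /= /S /= mulr_ge0 ?ler0n // ltW.
rewrite -vx -weight_vol weight_node !mulrDr /=.
rewrite -(eq_mean3 (g := fun a b c => f a + f b + f c)).
  by rewrite mean3_sum !lerD.
by move=> *; rewrite SE.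
Qed.

(** The cross terms only involve first moments, by independence; the excess
C - L^2 is therefore multiplied by the sum of the squares, which is smaller than
the square of the sum. *)
Lemma mean3_sqr g (C : R) i j k : (forall x, 0 <= g x) ->
  (forall n, mean n g <= L * s_ n) ->
  (forall n, mean n (fun x => g x ^+ 2) <= C * s_ n ^+ 2) ->
  mean3 i j k (fun a b c => (g a + g b + g c) ^+ 2) <=
    (C - L ^+ 2) * (s_ i ^+ 2 + s_ j ^+ 2 + s_ k ^+ 2) +
    L ^+ 2 * (s_ i + s_ j + s_ k) ^+ 2.
Proof.
move=> g0 g1 g2; pose one : shape -> R := fun=> 1.
rewrite (_ : mean3 _ _ _ _ =
  mean i (fun x => g x ^+ 2) + mean j (fun x => g x ^+ 2) +
  mean k (fun x => g x ^+ 2) + 2 * (mean i g * mean j g +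
  mean i g * mean k g + mean j g * mean k g)); last first.
  rewrite -mean3_sum.
  rewrite (_ : mean i g * mean j g = mean3 i j k (fun a b c => g a * g b * one c)); last first.
    by rewrite mean3M mean_cst mulr1.
  rewrite (_ : mean i g * mean k g = mean3 i j k (fun a b c => g a * one b * g c)); last first.
    by rewrite mean3M mean_cst mulr1.
  rewrite (_ : mean j g * mean k g = mean3 i j k (fun a b c => one a * g b * g c)); last first.
    by rewrite mean3M mean_cst mul1r.
  rewrite -!mean3D -mean3Z -mean3D; apply: eq_mean3 => a b c _ _ _.
  by rewrite /one; ring.
have m0 n : 0 <= mean n g.
  by rewrite -[0](mean_cst n); apply: le_mean.
have gg m n : mean m g * mean n g <= (L * s_ m) * (L * s_ n) by rewrite ler_pM.
have := gg i j; have := gg i k; have := gg j k.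
have := g2 i; have := g2 j; have := g2 k.
lra.
Qed.

Lemma mean_kids_sqr n :
  mean n (fun x => S x ^+ 2) <= 31 / 30 * L ^+ 2 * s_ n ^+ 2.
Proof.
case: n => [|n].
  rewrite mean0 /S /= expr0n /= mulr_ge0 ?sqr_ge0 // mulr_ge0 ?sqr_ge0 //; lra.
have := mean_children_sqr R n; set Q := mean _ _ => Qle.
suff : mean n.+1 (fun x => S x ^+ 2) <= L ^+ 2 / 18 * Q + L ^+ 2 * s_ n.+1 ^+ 2.
  have := sqr_ge0 L; move: Qle; nra.
rewrite -mean_resample -meanZ -[X in _ + X](mean_cst n.+1) -meanD.
apply: le_mean => -[//|a b c] vx.
rewrite -vx -weight_vol weight_node.
rewrite [leLHS](eq_mean3 (h := fun a b c => (f a + f b + f c) ^+ 2)); last first.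
  by move=> *; rewrite SE.
apply: le_trans (mean3_sqr _ _ _ f_ge0 mean_f mean_f2) _.
rewrite -!weight_vol /=; lra.
Qed.

Lemma mean_thin_sqr n :
  mean n (fun x => (thin V x)%:R ^+ 2) <= 31 / 30 * L ^+ 2 * s_ n ^+ 2.
Proof.
rewrite -mean_resample -[leRHS](mean_cst n); apply: le_mean => -[|a b c] vx.
  rewrite /= expr0n /= mulr_ge0 ?sqr_ge0 // mulr_ge0 ?sqr_ge0 //; lra.
rewrite -vx -weight_vol weight_node.
apply: (@le_trans _ _ (mean3 (vol a) (vol b) (vol c)
  (fun a b c => (S a + S b + S c) ^+ 2))).
  apply: le_mean3 => a' b' c' _ _ _.
  rewrite ler_sqr ?nnegrE ?addr_ge0 ?ler0n // -!natrD ler_nat /=; exact: leq_subr.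
apply: le_trans (mean3_sqr _ _ _ S_ge0 mean_kids mean_kids_sqr) _.
rewrite -!weight_vol.
have := weight_ge1 a; have := weight_ge1 b; have := weight_ge1 c.
have := exprn_gt0 2 L_gt0; move: (w a) (w b) (w c) (L ^+ 2) => u v t l *.
have : 0 <= u * v by rewrite mulr_ge0 //; lra.
have : 0 <= u * t by rewrite mulr_ge0 //; lra.
have : 0 <= v * t by rewrite mulr_ge0 //; lra.
move=> *; nra.
Qed.

(** With X = f x / (L w x) this is (L / 2) ((1 - X)^2 - 1), the contribution of
one grandchild to the quadratic lower bound of the minimum. For the missing
children of a leaf X = 0, and the contribution vanishes. *)
Let dev1 x : R := f x ^+ 2 / (2 * L * w x ^+ 2) - f x / w x.
Let dev x : R := if x is node a b c then dev1 a + dev1 b + dev1 c else 0.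

Let dev1_ge x : - (L / 2) <= dev1 x.
Proof.
have l0 := L_gt0.
have w0 := weight_gt0 R x.
rewrite -subr_ge0 (_ : _ - _ = (f x / w x - L) ^+ 2 / (2 * L)).
  by rewrite divr_ge0 ?sqr_ge0 //; lra.
rewrite /dev1; field; lra.
Qed.

(** The grandchild that attains the minimum: its own linear term is at least
minus its value as soon as [m] is at most its weight. *)
Let dev1_absorb x m : 0 <= m -> m <= w x -> - f x <= m * dev1 x.
Proof.
have l0 := L_gt0.
move=> m0 mw; have w0 := weight_gt0 R x.
rewrite -subr_ge0 (_ : _ - _ =
  m * (f x ^+ 2 / (2 * L * w x ^+ 2)) + (w x - m) * (f x / w x)).
  have fw : 0 <= f x / w x by rewrite divr_ge0 // ltW.
  have fw2 : 0 <= f x ^+ 2 / (2 * L * w x ^+ 2).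
    by rewrite divr_ge0 ?sqr_ge0 // mulr_ge0 ?sqr_ge0 //; lra.
  by apply: addr_ge0; apply: mulr_ge0 => //; rewrite subr_ge0.
rewrite /dev1; field; lra.
Qed.

Let kids_min_node a b c m : 0 <= m -> m <= w a -> m <= w b -> m <= w c ->
  - (kids_min V (node a b c))%:R <= m * (L + dev (node a b c)).
Proof.
have l0 := L_gt0.
move=> m0 /(dev1_absorb m0) ma /(dev1_absorb m0) mb /(dev1_absorb m0) mc.
have mdev x : - (m * L / 2) <= m * dev1 x.
  rewrite -mulrA -mulrN ler_wpM2l //; exact: dev1_ge.
move: (mdev a) (mdev b) (mdev c).
have -> : dev (node a b c) = dev1 a + dev1 b + dev1 c by [].
move: (dev1 a) (dev1 b) (dev1 c) ma mb mc => da db dc ma mb mc.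
have [->|[->|->]] : kids_min V (node a b c) = V a \/
    (kids_min V (node a b c) = V b \/ kids_min V (node a b c) = V c).
  by rewrite /=; lia.
- rewrite -/(f a); move: (f a) ma => y; lra.
- rewrite -/(f b); move: (f b) mb => y; lra.
- rewrite -/(f c); move: (f c) mc => y; lra.
Qed.

Let kids_min_dev x m : 0 <= m -> m <= 4 * spread x ->
  - (kids_min V x)%:R <= m * (L + dev x).
Proof.
have l0 := L_gt0.
case: x => [|a b c] m0 mx; first by rewrite /= addr0 oppr0 mulr_ge0 // ltW.
by have [? ? ?] := spread_le_kids a b c; apply: kids_min_node => //; lra.
Qed.

Let dev_ge x : - (3 / 2 * L) <= dev x.
Proof.
have l0 := L_gt0.
case: x => [|a b c] /=; first by lra.
by have := dev1_ge a; have := dev1_ge b; have := dev1_ge c; lra.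
Qed.

(** The inequality min X >= 1/2 - (1/2) sum (1 - X_j)^2, scaled by a lower bound
[m] of the grandchild weights: the child that contains the minimum contributes
at least minus the minimum, and each of the other two at least - (3/2) L m. *)
Lemma thin_dev a b c m : 0 <= m ->
    m <= 4 * spread a -> m <= 4 * spread b -> m <= 4 * spread c ->
  (thin V (node a b c))%:R <=
    S a + S b + S c + m * (4 * L + dev a + dev b + dev c).
Proof.
have l0 := L_gt0.
move=> m0 /(kids_min_dev m0) ma /(kids_min_dev m0) mb /(kids_min_dev m0) mc.
have mdev x : - (m * L * 3 / 2) <= m * dev x.
  apply: le_trans (ler_wpM2l m0 (dev_ge x)); lra.
move: (mdev a) (mdev b) (mdev c).
set mu := minn (kids_min V a) (minn (kids_min V b) (kids_min V c)).
have minS x : (kids_min V x <= kids_sum V x)%N.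
  by case: x => //= ? ? ?; rewrite geq_min -addnA leq_addr.
have -> : (thin V (node a b c))%:R = S a + S b + S c - mu%:R.
  rewrite /= natrB ?natrD //.
  by rewrite geq_min (leq_trans (minS a)) // -addnA leq_addr.
move: (dev a) (dev b) (dev c) ma mb mc => da db dc ma mb mc.
have [->|[->|->]] : mu = kids_min V a \/ (mu = kids_min V b \/ mu = kids_min V c).
  by rewrite /mu; lia.
- lra.
- lra.
- lra.
Qed.

(** Both moments of [f] enter with nonnegative coefficients, because [u] times
the spread is at most the weight of each child; so they can be replaced by their
upper bounds. The constant 17/12 is (3/2) (2 - 19/18). *)
Lemma mean_kids_dev u n : 0 <= u <= 4 ->
  mean n (fun x => S x + u * (spread x * dev x)) <=
    L * (s_ n - u * (17 / 12) * mean n spread).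
Proof.
have l0 := L_gt0.
move=> /andP[u0 u4]; case: n => [|n].
  rewrite !mean0 /= /S /size_weight /= !mulr0 addr0 mulr_ge0 ?ltW //; lra.
rewrite (_ : L * _ = mean n.+1 (fun x => L * s_ n.+1 +
   - (L * u * (17 / 12)) * spread x)); last first.
  by rewrite meanD mean_cst meanZ; ring.
rewrite -mean_resample; apply: le_mean => -[//|a b c] vx.
rewrite -vx -weight_vol weight_node.
set q := spread (node a b c).
have q0 : 0 < q := spread_gt0 _.
have bound t : q <= s_ t / 4 ->
    mean t (fun x => f x * (1 - u * q / s_ t) +
        u * q / (2 * L * s_ t ^+ 2) * f x ^+ 2) <=
    L * s_ t - L * (u * (17 / 36)) * q.
  move=> qt; have s0 : 0 < s_ t by have := size_weight_ge1 R t; lra.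
  rewrite (@eq_mean _ _ _ (fun x => (1 - u * q / s_ t) * f x +
        u * q / (2 * L * s_ t ^+ 2) * f x ^+ 2)); last by move=> *; ring.
  rewrite meanD !meanZ.
  have c1 : 0 <= 1 - u * q / s_ t.
    rewrite subr_ge0 ler_pdivrMr // mul1r; nra.
  have c2 : 0 <= u * q / (2 * L * s_ t ^+ 2).
    have [qw lw] := (ltW q0, ltW l0).
    by apply: divr_ge0; [apply: mulr_ge0 | rewrite !mulr_ge0 ?sqr_ge0].
  apply: le_trans (lerD (ler_wpM2l c1 (mean_f t)) (ler_wpM2l c2 (mean_f2 t))) _.
  rewrite le_eqVlt; apply/orP; left; apply/eqP; field; lra.
have [qa qb qc] := spread_le_kids a b c; rewrite -/q in qa qb qc.
rewrite [leLHS](eq_mean3 (h := fun x y z =>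
   (f x * (1 - u * q / s_ (vol a)) +
        u * q / (2 * L * s_ (vol a) ^+ 2) * f x ^+ 2) +
   (f y * (1 - u * q / s_ (vol b)) +
        u * q / (2 * L * s_ (vol b) ^+ 2) * f y ^+ 2) +
   (f z * (1 - u * q / s_ (vol c)) +
        u * q / (2 * L * s_ (vol c) ^+ 2) * f z ^+ 2))); last first.
  move=> x y z vx' vy vz; rewrite SE /dev /dev1 -vx' -vy -vz.
  have -> : spread (node x y z) = q.
    by rewrite /q /spread !weight_node /weight vx' vy vz.
  rewrite -!weight_vol.
  have := weight_gt0 R x; have := weight_gt0 R y; have := weight_gt0 R z.
  move=> *; field; lra.
rewrite mean3_sum.
have := bound _ qa; have := bound _ qb; have := bound _ qc.
rewrite -!weight_vol; lra.
Qed.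

(** The computation yields 2304 / (4 * 105^4), about 4.7 * 10^-6, for the gain of
one stage. *)
Definition thin_rate : R := (10 ^+ 6)^-1.

(** The bound of [thin_dev] is used with m = K q(a) q(b) q(c), where q is the
spread and K = 2304 / s^2. Being a product, it keeps the three children
independent: the two other factors become constants when one child is treated by
[mean_kids_dev]. *)
Lemma mean_thin n : mean n (fun x => (thin V x)%:R) <= L * (1 - thin_rate) * s_ n.
Proof.
have l0 := L_gt0.
case: n => [|n].
  rewrite mean0 /= /thin_rate !mulr_ge0 ?ltW ?size_weight_gt0 //; lra.
set s := s_ n.+1; have s1 : 1 <= s := size_weight_ge1 _ _.
have s0 : 0 < s by lra.
(* 2304 = 4 * 4 * 144: the spreads of two children of weights u and v have a
   product at most u v / 144 <= s^2 / (4 * 144), and m <= 4 q(x) is needed. *)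
pose K : R := 2304 / s ^+ 2.
have K0 : 0 < K by apply: divr_gt0; [rewrite ltr0n|exact: exprn_gt0].
pose P x := on_children (fun u v t : R => u * v * t) x.
pose e : R := L * (1 / 4 * K / 105 ^+ 3).
suff : mean n.+1 (fun x => (thin V x)%:R) <=
    mean n.+1 (fun x => L * s + - e * P x).
  move/le_trans; apply; rewrite meanD mean_cst meanZ mean_children_prod -/s.
  rewrite -subr_ge0 /thin_rate /e /K.
  set d := (_ - _); have -> : d = L * s * (1 / 4 * 2304 / 105 ^+ 4 *
     ((s + 2) * (s + 4) / s ^+ 2) - (10 ^+ 6)^-1) by rewrite /d; field; lra.
  have : 1 <= (s + 2) * (s + 4) / s ^+ 2.
    by rewrite ler_pdivlMr ?exprn_gt0 //; nra.
  move: (_ / s ^+ 2) => y y1.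
  by apply: mulr_ge0; [apply: mulr_ge0; exact: ltW | lra].
rewrite -mean_resample; apply: le_mean => -[//|a b c] vx.
have sE : s = w a + w b + w c by rewrite -weight_node weight_vol vx.
pose q := spread; pose qd x : R := q x * dev x.
set i := vol a; set j := vol b; set k := vol c.
set Q := fun n => mean n q.
have Q0 t : 0 <= Q t.
  by have := mean_spread_ge t; have := size_weight_ge1 R t; rewrite /Q /q; lra.
apply: (@le_trans _ _ (mean3 i j k (fun x y z =>
    S x + S y + S z + (K * 4 * L) * (q x * q y * q z) +
    K * (qd x * q y * q z) + K * (q x * qd y * q z) + K * (q x * q y * qd z)))).
  apply: le_mean3 => x y z vx' vy vz.
  have [sx sy sz] : [/\ w x = w a, w y = w b & w z = w c].
    by rewrite /weight vx' vy vz.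
  have prod_le4 u v t p q' r : 0 < u -> 0 < v -> 0 < t -> u + v + t = s ->
      0 < p <= u / 12 -> 0 < q' <= v / 12 -> 0 < r -> K * p * q' * r <= 4 * r.
    move=> u0 v0 t0 uvt /andP[p0 pu] /andP[q'0 qv] r0.
    rewrite ler_wpM2r ?(ltW r0) // /K -!mulrA [_^-1 * _]mulrC mulrA.
    rewrite ler_pdivrMr ?exprn_gt0 //.
    have : p * q' <= u / 12 * (v / 12) by rewrite ler_pM // ltW.
    have : 4 * (u * v) <= s ^+ 2 by have := sqr_ge0 (u - v); rewrite -uvt; nra.
    lra.
  have sp t : 0 < spread t <= w t / 12 by rewrite spread_gt0 spread_le.
  have [[x0 y0] z0] := (weight_gt0 R x, weight_gt0 R y, weight_gt0 R z).
  have q_ge0 t : 0 <= q t by exact: ltW (spread_gt0 t).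
  have m0 : 0 <= K * q x * q y * q z.
    by do 3![apply: mulr_ge0 => //]; exact: ltW.
  apply: le_trans (thin_dev m0 _ _ _) _; last by rewrite /qd; lra.
  - rewrite [leLHS](_ : _ = K * q y * q z * q x); last by ring.
    apply: (prod_le4 (w y) (w z) (w x)) => //; try exact: sp; try exact: spread_gt0.
    by rewrite sE -sx -sy -sz; ring.
  - rewrite [leLHS](_ : _ = K * q x * q z * q y); last by ring.
    apply: (prod_le4 (w x) (w z) (w y)) => //; try exact: sp; try exact: spread_gt0.
    by rewrite sE -sx -sy -sz; ring.
  - apply: (prod_le4 (w x) (w y) (w z)) => //; try exact: sp; try exact: spread_gt0.
    by rewrite sE -sx -sy -sz; ring.
rewrite 4!mean3D mean3_sum !mean3Z !mean3M.
have kd u t : 0 <= u <= 4 -> mean t S + u * mean t qd <= L * (s_ t - u * (17 / 12) * Q t).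
  by move=> /(mean_kids_dev t); rewrite meanD meanZ.
have K4 t1 t2 : s_ t1 + s_ t2 <= s -> 0 <= K * Q t1 * Q t2 <= 4.
  move=> tts; apply/andP; split.
    by do 2![apply: mulr_ge0 => //]; exact: ltW.
  have -> : K * Q t1 * Q t2 = 2304 * (Q t1 * Q t2) / s ^+ 2 by rewrite /K; ring.
  rewrite ler_pdivrMr ?exprn_gt0 //.
  have [v1 v2] := (size_weight_ge1 R t1, size_weight_ge1 R t2).
  have : Q t1 * Q t2 <= s_ t1 / 12 * (s_ t2 / 12).
    by rewrite ler_pM // mean_spread_le.
  move: tts v1 v2 s0; move: (s_ t1) (s_ t2) (s) (Q t1 * Q t2) => u v s' p.
  move=> uvs u1 v1 s0 pl.
  have : 4 * (u * v) <= s' ^+ 2 by have := sqr_ge0 (u - v); nra.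
  lra.
have [wi wj wk] : [/\ w a = s_ i, w b = s_ j & w c = s_ k] by [].
have [[i1 j1] k1] := (size_weight_ge1 R i, size_weight_ge1 R j, size_weight_ge1 R k).
rewrite wi wj wk in sE.
have h1 : 0 <= K * Q j * Q k <= 4 by apply: K4; lra.
have h2 : 0 <= K * Q i * Q k <= 4 by apply: K4; lra.
have h3 : 0 <= K * Q i * Q j <= 4 by apply: K4; lra.
move: (kd _ i h1) (kd _ j h2) (kd _ k h3).
rewrite /P /= wi wj wk.
have : 1 / 105 ^+ 3 * (s_ i * s_ j * s_ k) <= Q i * Q j * Q k.
  rewrite [leLHS](_ : _ = s_ i / 105 * (s_ j / 105) * (s_ k / 105)); last by field.
  have z105 t : 1 <= s_ t -> 0 <= s_ t / 105 by lra.
  have [zi zj zk] := And3 (z105 _ i1) (z105 _ j1) (z105 _ k1).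
  apply: ler_pM => //; [exact: mulr_ge0| |exact: mean_spread_ge].
  by apply: ler_pM => //; exact: mean_spread_ge.
move/(ler_wpM2l (ltW (mulr_gt0 l0 K0))).
rewrite /e -/(Q i) -/(Q j) -/(Q k) sE.
lra.
Qed.

End Step.

(** The ratio 19/18 of the moments is stable under one stage because
31/30 <= (19/18) (1 - 10^-6)^2. *)
Lemma mean_kept k n :
  mean n (fun x => (kept k x)%:R) <= (1 - thin_rate) ^+ k * s_ n.
Proof.
have rate : thin_rate = (10 ^+ 6)^-1 by [].
have b0 : 0 < 1 - thin_rate by lra.
suff [] : (forall n, mean n (fun x => (kept k x)%:R) <=
      (1 - thin_rate) ^+ k * s_ n) /\
    (forall n, mean n (fun x => (kept k x)%:R ^+ 2) <=
      19 / 18 * ((1 - thin_rate) ^+ k) ^+ 2 * s_ n ^+ 2) by [].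
elim: k => [|k [IH1 IH2]].
  split=> m; rewrite expr0 ?mul1r -[leRHS](mean_cst m); apply: le_mean => x <-.
    by [].
  by have := sqr_ge0 (w x); rewrite expr1n mulr1 -weight_vol /weight /kept /=; lra.
have Lk : 0 < (1 - thin_rate) ^+ k by exact: exprn_gt0.
split=> m; rewrite [_ ^+ k.+1]exprSr; first exact: mean_thin.
apply: le_trans (mean_thin_sqr Lk IH1 IH2 m) _.
rewrite ler_wpM2r ?sqr_ge0 // exprMn.
have := sqr_ge0 ((1 - thin_rate) ^+ k); move: (_ ^+ k ^+ 2) => l; rewrite rate; lra.
Qed.

End Moments.

(** * Networks as labelled trees *)
Inductive ltree := lleaf | lnode of nat & ltree & ltree & ltree.
HB.instance Definition _ := gen_eqMixin ltree.

Section LabelledTrees.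
Local Open Scope nat_scope.

Definition corners (f : face) : seq nat := [:: f.1.1; f.1.2; f.2].
(** The three faces created when [v] is inserted in [f], in the order of
[insert_vertex]. *)
Definition sub1 (f : face) (v : nat) : face := (f.1.1, f.1.2, v).
Definition sub2 (f : face) (v : nat) : face := (f.1.2, f.2, v).
Definition sub3 (f : face) (v : nat) : face := (f.2, f.1.1, v).
Definition spokes (f : face) (v : nat) : seq (nat * nat) :=
  [:: (f.1.1, v); (f.1.2, v); (f.2, v)].

Fixpoint erase (T : ltree) : shape :=
  if T is lnode _ A B C then node (erase A) (erase B) (erase C) else leaf.

Fixpoint verts (T : ltree) : seq nat :=
  if T is lnode v A B C then v :: verts A ++ verts B ++ verts C else [::].

Fixpoint faces_of (f : face) (T : ltree) : seq face :=
  if T is lnode v A B C then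
    faces_of (sub1 f v) A ++ faces_of (sub2 f v) B ++ faces_of (sub3 f v) C
  else [:: f].

Fixpoint edges_of (f : face) (T : ltree) : seq (nat * nat) :=
  if T is lnode v A B C then
    spokes f v ++
    edges_of (sub1 f v) A ++ edges_of (sub2 f v) B ++ edges_of (sub3 f v) C
  else [::].

(** The subdivisions of the leaves by the vertex [v], each with the face that it
subdivides, in the same order as in [growths] and [faces_of]. *)
Fixpoint lgrowths (v : nat) (f : face) (T : ltree) : seq (face * ltree) :=
  if T is lnode u A B C then
    [seq (p.1, lnode u p.2 B C) | p <- lgrowths v (sub1 f u) A] ++
    [seq (p.1, lnode u A p.2 C) | p <- lgrowths v (sub2 f u) B] ++
    [seq (p.1, lnode u A B p.2) | p <- lgrowths v (sub3 f u) C]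
  else [:: (f, lnode v lleaf lleaf lleaf)].

Lemma lgrowths_faces v f T : [seq p.1 | p <- lgrowths v f T] = faces_of f T.
Proof.
by elim: T f => //= u A IHA B IHB C IHC f; rewrite !map_cat -!map_comp -IHA -IHB -IHC.
Qed.

Lemma lgrowths_erase v f T :
  [seq erase p.2 | p <- lgrowths v f T] = growths (erase T).
Proof.
elim: T f => //= u A IHA B IHB C IHC f; rewrite !map_cat -!map_comp.
by rewrite -(IHA (sub1 f u)) -(IHB (sub2 f u)) -(IHC (sub3 f u)) -!map_comp.
Qed.

Lemma lgrowthsP v f T p : p \in lgrowths v f T ->
  [/\ perm_eq (verts p.2) (v :: verts T),
      perm_eq (edges_of f p.2) (spokes p.1 v ++ edges_of f T) &
      perm_eq (p.1 :: faces_of f p.2)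
        ([:: sub1 p.1 v; sub2 p.1 v; sub3 p.1 v] ++ faces_of f T)].
Proof.
elim: T f p => [|u A IHA B IHB C IHC] f p.
  by rewrite inE => /eqP-> /=; split=> //; apply/permP => a /=; lia.
rewrite /= !mem_cat => /or3P[] /mapP[[g T']];
  [move/IHA|move/IHB|move/IHC] => -[/permP V /permP E /permP F] -> /=;
  (split; apply/permP => a;
     [move: (V a)|move: (E a)|move: (F a)]; rewrite /= !count_cat /=; lia).
Qed.

(** A face that is not the root face was created by an inserted vertex, which
comes third among its corners. *)
Lemma faces_ofP f T g :
  g \in faces_of f T -> (g = f /\ T = lleaf) \/ g.2 \in verts T.
Proof.
elim: T f => [|u A IHA B IHB C IHC] f /=; first by rewrite inE => /eqP; left.
rewrite !mem_cat => /or3P[/IHA|/IHB|/IHC] H; right; move: H.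
- by case=> [[-> _]|gA]; rewrite inE ?eqxx // !mem_cat gA orbT.
- by case=> [[-> _]|gA]; rewrite inE ?eqxx // !mem_cat gA !orbT.
- by case=> [[-> _]|gA]; rewrite inE ?eqxx // !mem_cat gA !orbT.
Qed.

Lemma uniq_of_count (s t : seq nat) :
  uniq t -> (forall x, count_mem x s <= count_mem x t) -> uniq s.
Proof.
move=> /count_uniq_mem ut st; apply: count_mem_uniq => x.
have := leq_trans (st x) (leq_trans (eq_leq (ut x)) (leq_b1 _)).
by rewrite -[x \in s]has_pred1 has_count; case: (count _ s) => [|[]].
Qed.

Lemma uniq_faces_of f T : uniq (corners f ++ verts T) -> uniq (faces_of f T).
Proof.
elim: T f => [//|u A IHA B IHB C IHC] f uf.
have disj (f1 f2 : face) (T1 T2 : ltree) : f1 != f2 -> f1.2 = u -> f2.2 = u ->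
    uniq (u :: verts T1 ++ verts T2) ->
    ~~ has (mem (faces_of f1 T1)) (faces_of f2 T2).
  move=> f12 f1u f2u /=; rewrite mem_cat cat_uniq negb_or.
  move=> /and3P[/andP[u1 u2] _ /andP[/hasPn d12 _]].
  apply/hasPn => g /faces_ofP g2; apply/negP => /faces_ofP g1.
  case: g1 g2 => [[-> _]|g1] [[g2 _]|g2].
  - by rewrite g2 eqxx in f12.
  - by rewrite f1u (negbTE u2) in g2.
  - by rewrite g2 f2u (negbTE u1) in g1.
  - by have := d12 _ g2; rewrite /= g1.
have [ab bc ca] : [/\ f.1.1 != f.1.2, f.1.2 != f.2 & f.2 != f.1.1].
  move: uf; rewrite /= !inE !mem_cat !negb_or [f.2 == f.1.1]eq_sym.
  by case/and4P => /and3P[-> -> _] /andP[-> _].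
rewrite /= !cat_uniq has_cat negb_or.
have usub (g : face) (t : ltree) :
   (forall x, count_mem x (corners g ++ verts t) <=
      count_mem x (corners f ++ verts (lnode u A B C))) -> uniq (corners g ++ verts t).
  exact: uniq_of_count.
rewrite IHA ?IHB ?IHC; last first.
- by apply: usub => x; rewrite /= !count_cat /=; lia.
- by apply: usub => x; rewrite /= !count_cat /=; lia.
- by apply: usub => x; rewrite /= !count_cat /=; lia.
have udisj t1 t2 : (forall x, count_mem x (u :: verts t1 ++ verts t2) <=
      count_mem x (corners f ++ verts (lnode u A B C))) ->
    uniq (u :: verts t1 ++ verts t2).
  exact: uniq_of_count.
have neq (f1 f2 : face) : f1.1.1 != f2.1.1 -> f1 != f2.
  by apply: contraNneq => ->.
rewrite /= !disj //= ?neq //= 1?eq_sym //.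
- by apply: udisj => x; rewrite /= !count_cat /=; lia.
- by apply: udisj => x; rewrite /= !count_cat /=; lia.
- by apply: udisj => x; rewrite /= !count_cat /=; lia.
Qed.

Definition outer : face := (0, 1, 2).

(** The tree [T], read inside the outer triangle, describes the network [G]. *)
Definition models (G : plane_graph) (T : ltree) : Prop :=
  [/\ perm_eq (corners outer ++ verts T) (iota 0 (nvert G)),
      perm_eq (edges G) (edges triangle ++ edges_of outer T) &
      perm_eq (bfaces G) (faces_of outer T)].

Lemma models_triangle : models triangle lleaf.
Proof. by []. Qed.

Lemma models_insert G T p : models G T ->
  p \in lgrowths (nvert G) outer T -> models (insert_vertex G p.1) p.2.
Proof.
case: p => [[[a b] c] T'] [V E F] pT; have [V' E' F'] := lgrowthsP pT.
have gG : (a, b, c) \in bfaces G.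
  by rewrite (perm_mem F) -(lgrowths_faces (nvert G)) (map_f (@fst _ _) pT).
split.
- rewrite [nvert _]/= -addn1 iotaD add0n.
  apply: (@perm_trans _ ([:: nvert G] ++ (corners outer ++ verts T))).
    by rewrite perm_sym perm_catCA perm_cat2l perm_sym.
  by rewrite perm_catC perm_cat2r.
- rewrite [edges (insert_vertex _ _)](_ : _ = spokes (a, b, c) (nvert G) ++ edges G) //.
  apply: (@perm_trans _ (edges triangle ++ spokes (a, b, c) (nvert G) ++ edges_of outer T)).
    by rewrite perm_sym perm_catCA perm_cat2l perm_sym.
  by rewrite perm_cat2l perm_sym.
- rewrite -(perm_cons (a, b, c)); apply: perm_trans; last by rewrite perm_sym; exact: F'.
  rewrite -cat1s -[bfaces (insert_vertex _ _)]/([:: sub1 (a, b, c) (nvert G);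
    sub2 (a, b, c) (nvert G); sub3 (a, b, c) (nvert G)] ++ rem (a, b, c) (bfaces G)).
  rewrite perm_catCA perm_cat2l cat1s.
  by apply: perm_trans F; rewrite perm_sym; exact: perm_to_rem.
Qed.

Lemma models_uniq G T : models G T -> uniq (corners outer ++ verts T).
Proof. by case=> /perm_uniq-> _ _; exact: iota_uniq. Qed.

Lemma models_uniq_faces G T : models G T -> uniq (bfaces G).
Proof.
by move=> GT; case: (GT) => _ _ /perm_uniq->; apply/uniq_faces_of/models_uniq/GT.
Qed.

Lemma size_faces_of f T : size (faces_of f T) = (2 * vol (erase T)).+1.
Proof. by rewrite -size_growths -(lgrowths_erase 0 f) -(lgrowths_faces 0 f) !size_map. Qed.

(** * A path misses one grandchild out of nine *)
Section Paths.
Variable e : rel nat.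

(** Two different regions visited one after the other are separated by a visit
to [K]. *)
Lemma regions_visited_le (K : seq nat) (Cs : seq (seq nat)) (p : seq nat) :
  uniq (K ++ flatten Cs) ->
  (forall C x y, C \in Cs -> x \in C -> e x y -> y \in C ++ K) ->
  sorted e p ->
  count (fun C => has (mem C) p) Cs <= (count (mem K) p).+1.
Proof.
rewrite cat_uniq => /and3P[_ /hasPn KC uC] sep.
have one x : count (fun C : seq nat => x \in C) Cs <= 1.
  move/count_uniq_mem: uC => uC; apply: leq_trans (leq_b1 (x \in flatten Cs)).
  rewrite -uC; elim: Cs {KC uC sep} => //= C Cs IH; rewrite count_cat leq_add //.
  by rewrite -has_pred1 has_count; case: (count _ C).
have zero x : x \in K -> count (fun C : seq nat => x \in C) Cs = 0.
  move=> xK; apply/eqP; rewrite -leqn0 leqNgt -has_count; apply/hasP => -[C CCs xC].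
  by have := KC x; rewrite /= xK => /implyP; rewrite implybF; move/negP; apply; apply/flattenP; exists C.
have cnt_cons x q : count (fun C : seq nat => has (mem C) (x :: q)) Cs <=
    count (fun C : seq nat => x \in C) Cs + count (fun C : seq nat => has (mem C) q) Cs.
  by rewrite -count_predUI leq_addr.
(* A walk that starts in K is not inside a region at the start, which saves one
   and makes the induction go through. *)
suff main q : sorted e q -> count (fun C => has (mem C) q) Cs <=
    count (mem K) q + (if q is x :: _ then x \notin K else false).
  move=> /main; case: p => [|x p] H; apply: leq_trans H _; first by [].
  by case: (x \in K); rewrite /=; lia.
elim: q => [|x q IHq] /=; first by rewrite count_pred0.
move=> exq; have sq : sorted e q by case: q exq {IHq} => //= y q /andP[].
have := IHq sq; have := cnt_cons x q; rewrite /=.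
have [/zero-> | xK] := boolP (x \in K).
  by case: q {IHq sq exq} => [|y q] /=; lia.
have := one x; case: q exq {IHq sq} => [|y q] /= exq.
  by rewrite count_pred0; lia.
have [yK|yK] := boolP (y \in K); first by lia.
move=> _ _ IH; rewrite add0n -addnA; apply: leq_trans IH.
apply: eq_leq; apply: eq_in_count => C CCs /=.
have [xC|//] := boolP (x \in C).
have /andP[exy _] := exq; have := sep C x y CCs xC exy.
by rewrite mem_cat (negbTE yK) orbF => ->.
Qed.

(** All edges of [e] at an inner vertex of [T] are edges of [T]. This local form
of being a network passes to the subtrees. *)
Definition local f T : Prop :=
  uniq (corners f ++ verts T) /\
  forall x y, e x y -> x \in verts T ->
    (x, y) \in edges_of f T \/ (y, x) \in edges_of f T.

Lemma mem_edges_of f v A B C d : d \in edges_of f (lnode v A B C) =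
  [|| d \in spokes f v, d \in edges_of (sub1 f v) A,
      d \in edges_of (sub2 f v) B | d \in edges_of (sub3 f v) C].
Proof. by rewrite -!mem_cat. Qed.

Lemma edges_of_ends f T x y : (x, y) \in edges_of f T ->
  (x \in corners f ++ verts T) /\ (y \in verts T).
Proof.
elim: T f => [//|u A IHA B IHB C IHC] f.
rewrite mem_edges_of => /or4P[|/IHA|/IHB|/IHC].
- rewrite !inE => /or3P[] /eqP[-> ->]; rewrite !eqxx ?orbT //.
- by rewrite /= !(inE, mem_cat) => -[/or4P[]-> ->]; rewrite ?orbT.
- by rewrite /= !(inE, mem_cat) => -[/or4P[]-> ->]; rewrite ?orbT.
- by rewrite /= !(inE, mem_cat) => -[/or4P[]-> ->]; rewrite ?orbT.
Qed.

Lemma local_sep f T x y : local f T -> e x y -> x \in verts T ->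
  y \in corners f ++ verts T.
Proof.
move=> [_ loc] exy xT; rewrite mem_cat; case: (loc x y exy xT) => /edges_of_ends[].
  by move=> _ ->; rewrite orbT.
by rewrite mem_cat.
Qed.

(** The three children play the same role up to a rotation of the corners. *)
Lemma local_rot a b c v A B C :
  local (a, b, c) (lnode v A B C) -> local (b, c, a) (lnode v B C A).
Proof.
case=> uT loc; split.
  by apply: uniq_of_count uT _ => x; rewrite /= !count_cat /=; lia.
move=> x y exy xT; have {}xT : x \in verts (lnode v A B C).
  by move: xT; rewrite /= !inE !mem_cat => /or4P[] ->; rewrite ?orbT.
have E : edges_of (b, c, a) (lnode v B C A) =i edges_of (a, b, c) (lnode v A B C).
  apply: perm_mem; apply/permP => p.
  by rewrite /= /sub1 /sub2 /sub3 /= !count_cat; lia.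
by rewrite !E; exact: loc.
Qed.

Lemma local_sub1 f v A B C : local f (lnode v A B C) -> local (sub1 f v) A.
Proof.
case: f => [[a b] c] [uT loc]; split.
  by apply: uniq_of_count uT _ => x; rewrite /= !count_cat /=; lia.
move=> x y exy xA.
have notB z : z \in [:: a; b; c; v] ++ verts B ++ verts C -> z != x.
  move=> zB; apply: contraTneq uT => zx; move: zB; rewrite {z}zx => xB.
  apply/negP => /(count_uniq_mem x).
  have : 0 < count_mem x (verts A) by rewrite -has_count has_pred1.
  have : 0 < count_mem x ([:: a; b; c; v] ++ verts B ++ verts C).
    by rewrite -has_count has_pred1.
  rewrite /= !count_cat /= => ? ?; case: (_ \in _); lia.
have other g T' z t : (forall u, u \in corners g ++ verts T' ->
     u \in [:: a; b; c; v] ++ verts B ++ verts C) ->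
    (z, t) \in edges_of g T' -> (z != x) /\ (t != x).
  move=> sub /edges_of_ends[zT tT]; split; apply: notB; apply: sub => //.
  by rewrite mem_cat tT orbT.
have edge z t : (z, t) \in edges_of (a, b, c) (lnode v A B C) ->
    (z == x) || (t == x) -> (z, t) \in edges_of (a, b, v) A.
  rewrite mem_edges_of => /or4P[|//|/other|/other].
  - rewrite /spokes /= !inE => /or3P[] /eqP[-> ->] zt; exfalso; move: zt.
    + by rewrite !(negbTE (notB _ _)) // !inE eqxx ?orbT.
    + by rewrite !(negbTE (notB _ _)) // !inE eqxx ?orbT.
    + by rewrite !(negbTE (notB _ _)) // !inE eqxx ?orbT.
  - case=> [u|/negbTE-> /negbTE->] //.
    by rewrite /= !(inE, mem_cat) => /or4P[]->; rewrite ?orbT.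
  - case=> [u|/negbTE-> /negbTE->] //.
    by rewrite /= !(inE, mem_cat) => /or4P[]->; rewrite ?orbT.
have xT : x \in verts (lnode v A B C) by rewrite /= inE mem_cat xA orbT.
case: (loc x y exy xT) => /edge; rewrite eqxx ?orbT => /(_ isT); by [left|right].
Qed.

Lemma local_kids f v A B C : local f (lnode v A B C) ->
  [/\ local (sub1 f v) A, local (sub2 f v) B & local (sub3 f v) C].
Proof.
case: f => [[a b] c] loc; have loc' := local_rot loc; have loc'' := local_rot loc'.
by split; [have := local_sub1 loc|have := local_sub1 loc'|have := local_sub1 loc''].
Qed.

Section Count.
Variable p : seq nat.
Hypothesis up : uniq p.
Hypothesis ep : sorted e p.

Let cnt T := count (mem (verts T)) p.

Lemma count_mem_le (s : seq nat) : count (mem s) p <= size s.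
Proof.
rewrite -size_filter; apply: uniq_leq_size; first exact: filter_uniq.
by move=> x; rewrite mem_filter => /andP[].
Qed.

Lemma cnt_node v A B C : cnt (lnode v A B C) <= (cnt A + cnt B + cnt C).+1.
Proof.
have -> : cnt (lnode v A B C) = count (predU (mem [:: v])
    (predU (mem (verts A)) (predU (mem (verts B)) (mem (verts C))))) p.
  by apply: eq_count => x; rewrite /= !inE !mem_cat.
have cU a1 a2 : count (predU a1 a2) p <= count a1 p + count a2 p.
  by rewrite -count_predUI leq_addr.
apply: leq_trans (cU _ _) _; rewrite -add1n leq_add ?(count_mem_le [:: v]) //.
apply: leq_trans (cU _ _) _; rewrite -addnA leq_add //; exact: cU.
Qed.

(** The cut set consists of the three corners and the four inserted vertices: at
most seven visits to it leave room for eight regions. *)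
Lemma missed_grandchild f v v1 v2 v3 A1 A2 A3 B1 B2 B3 C1 C2 C3 :
  local f (lnode v (lnode v1 A1 A2 A3) (lnode v2 B1 B2 B3) (lnode v3 C1 C2 C3)) ->
  has (fun T => cnt T == 0) [:: A1; A2; A3; B1; B2; B3; C1; C2; C3].
Proof.
set Ts := [:: A1; _; _; _; _; _; _; _; _] => loc.
pose K := corners f ++ [:: v; v1; v2; v3].
have [l1 l2 l3] := local_kids loc.
have [a1 a2 a3] := local_kids l1.
have [b1 b2 b3] := local_kids l2.
have [c1 c2 c3] := local_kids l3.
have uK : uniq (K ++ flatten [seq verts T | T <- Ts]).
  case: loc => /uniq_of_count uT _; apply: uT => x.
  by rewrite /K /= !(count_cat, cats0) /= !count_cat /= ?count_cat; lia.
apply/negPn; rewrite -all_predC; apply/negP => /allP all_pos.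
suff : count (fun C => has (mem C) p) [seq verts T | T <- Ts] <= (count (mem K) p).+1.
  have -> : count (fun C => has (mem C) p) [seq verts T | T <- Ts] = 9.
    rewrite count_map (eq_in_count (a2 := predT)) ?count_predT // => T /all_pos /=.
    by rewrite has_count lt0n.
  by have := count_mem_le K; rewrite /K /=; lia.
apply: regions_visited_le => // R x y RTs xR exy.
have sep g S : local g S -> x \in verts S -> (forall z, z \in corners g -> z \in K) ->
    y \in verts S ++ K.
  move=> lS xS gK; have := local_sep lS exy xS; rewrite !mem_cat orbC.
  by case: (y \in verts S) => //= /gK; rewrite /K mem_cat.
move: RTs xR; rewrite !in_cons in_nil orbF.
by do 8?[case/orP]; move=> /eqP-> /sep S; (apply: S; first by eassumption);
  move=> z; rewrite /K !inE => /or3P[] ->; rewrite ?orbT.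
Qed.

(** The strict inequality absorbs the four inserted vertices at each stage:
4 + 8 (9^k - 1) < 9^(k+1), and six grandchildren at most are present if a child
is not subdivided. *)
Lemma count_kept k f T : local f T -> cnt T < 9 ^ k + kept k (erase T).
Proof.
elim: k f T => [|k IHk] f T loc.
  apply: leq_ltn_trans (count_mem_le _) _; rewrite expn0 /kept /=.
  suff -> : size (verts T) = vol (erase T) by lia.
  elim: T {loc} => //= v A IHA B IHB C IHC.
  by rewrite !size_cat IHA IHB IHC addnA.
have k0 : 0 < 9 ^ k by rewrite expn_gt0.
case: T loc => [|v A B C] loc; first by rewrite /cnt /= count_pred0 expnS; lia.
have [lA lB lC] := local_kids loc.
have := cnt_node v A B C; rewrite expnS /kept /= -/(kept k).
have kid g T : local g T ->
    (T = lleaf) \/ exists v T1 T2 T3, [/\ T = lnode v T1 T2 T3,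
   cnt T <= (cnt T1 + cnt T2 + cnt T3).+1,
   cnt T1 < 9 ^ k + kept k (erase T1),
   cnt T2 < 9 ^ k + kept k (erase T2) &
   cnt T3 < 9 ^ k + kept k (erase T3)].
  case: T => [|u T1 T2 T3] lT; [by left | right; exists u, T1, T2, T3].
  have [l1 l2 l3] := local_kids lT; split=> //.
  - exact: cnt_node.
  - exact: IHk l1.
  - exact: IHk l2.
  - exact: IHk l3.
have c0 : cnt lleaf = 0 by rewrite /cnt /= count_pred0.
case: (kid _ _ lA) (kid _ _ lB) (kid _ _ lC)
  => [->|[v1 [A1 [A2 [A3 [eA a0 a1 a2 a3]]]]]]
     [->|[v2 [B1 [B2 [B3 [eB b0 b1 b2 b3]]]]]]
     [->|[v3 [C1 [C2 [C3 [eC d0 d1 d2 d3]]]]]].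
1-7: rewrite ?eA ?eB ?eC ?c0 /= ?minn0 ?min0n ?subn0;
  rewrite -?eA -?eB -?eC; lia.
subst A B C; have := missed_grandchild loc.
rewrite /= orbF; set M := minn (minn _ _) _.
have : all (fun S => M <= kept k (erase S)) [:: A1; A2; A3; B1; B2; B3; C1; C2; C3].
  by rewrite /= /M !geq_min !leqnn !orbT.
move: M => M /=; do 8![case/andP => ?]; rewrite andbT => ?.
by do 8?[case/orP]; move=> /eqP; lia.
Qed.
End Count.

End Paths.

Lemma models_local G T : models G T -> local (adj G) outer T.
Proof.
move=> GT; split; first exact: models_uniq GT.
have noT x : x \in verts T -> x \notin corners outer.
  move=> xT; have := models_uniq GT; rewrite cat_uniq => /and3P[_ /hasPn/(_ x xT)].
  by [].
case: GT => _ E _ x y; rewrite /adj !(perm_mem E) !mem_cat => exy xT.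
have tri : forall z t, (z, t) \in edges triangle ->
    z \in corners outer /\ t \in corners outer.
  by move=> z t; rewrite !inE => /or3P[] /eqP[-> ->].
have := noT x xT.
by case/orP: exy => /orP[/tri[z1 z2]|]; rewrite ?z1 ?z2 //; [left|right].
Qed.

Lemma longest_path_kept k G T : models G T ->
  longest_path G < 3 + (9 ^ k + kept k (erase T)).
Proof.
move=> GT; have loc := models_local GT.
rewrite ltnS; apply/bigmax_leqP => n /existsP[p /andP[up sp]].
pose q := [seq val i | i <- p].
have uq : uniq q by rewrite map_inj_uniq //; exact: val_inj.
have sq : sorted (adj G) q by rewrite /q sorted_map.
have := count_kept uq sq k loc.
suff : nat_of_ord n <= 3 + count (mem (verts T)) q by lia.
have -> : nat_of_ord n = count (mem (corners outer ++ verts T)) q.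
  rewrite -(size_tuple p) -(size_map val) -/q -[LHS]count_predT.
  apply: eq_in_count => x /mapP[i _ ->]; case: GT => V _ _.
  by apply/esym/(etrans (perm_mem V _)); rewrite mem_iota /= add0n ltn_ord.
rewrite (eq_count (a2 := predU (mem (corners outer)) (mem (verts T)))); last first.
  by move=> x; exact: mem_cat.
have := count_predUI (mem (corners outer)) (mem (verts T)) q.
have := count_mem_le uq (corners outer).
by rewrite (_ : size (corners outer) = 3) //; lia.
Qed.

Lemma nvert_insert G f : nvert (insert_vertex G f) = (nvert G).+1.
Proof. by case: f => [[a b] c]. Qed.

Lemma longest_path_insert G f : longest_path G <= longest_path (insert_vertex G f).
Proof.
apply/bigmax_leqP => n /existsP[p /andP[up sp]].
have GG : nvert G <= nvert (insert_vertex G f) by rewrite nvert_insert.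
have nn : n < (nvert (insert_vertex G f)).+1 by rewrite ltnS (leq_trans _ GG) // -ltnS.
apply: (@leq_bigmax_cond _ _ (fun i : 'I__ => nat_of_ord i) (Ordinal nn)).
apply/existsP; exists [tuple of [seq widen_ord GG i | i <- p]].
rewrite /= map_inj_uniq ?up /=; last first.
  by move=> i j /(congr1 val) /= /val_inj.
rewrite sorted_map; apply: sub_sorted sp => i j.
rewrite /= /adj; case: f {GG nn} => [[a b] c] /=; rewrite !inE.
by case/orP => ->; rewrite !orbT.
Qed.

Lemma longest_path_ran c s t : s <= t -> longest_path (ran c s) <= longest_path (ran c t).
Proof.
move=> /subnK <-; elim: (t - s) => // m IH.
by rewrite addSn; apply: leq_trans IH _; exact: longest_path_insert.
Qed.

End LabelledTrees.

Lemma eq_ran c c' t : (forall s, (s < t)%N -> c s = c' s) -> ran c t = ran c' t.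
Proof.
elim: t => //= t IHt cc'; rewrite IHt => [|s st]; last by rewrite cc' // ltnW.
by rewrite cc'.
Qed.

(** * The law of the network *)
Section Law.
Context (R : realType) (d : measure_display) (T : measurableType d).
Context (P : probability T R) (F : nat -> T -> face).
Hypothesis unifF : uniform_face_choices P F.

Let pr (A : set T) : R := fine (P A).

Let prE A : measurable A -> P A = (pr A)%:E.
Proof. by move=> mA; rewrite /pr fineK // fin_num_measure. Qed.

Let pr_ge0 A : 0 <= pr A.
Proof. exact/fine_ge0/measure_ge0. Qed.

Let pr0 : pr set0 = 0.
Proof. by rewrite /pr measure0. Qed.

Let prS A B : measurable A -> measurable B -> A `<=` B -> pr A <= pr B.
Proof. by move=> mA mB AB; rewrite -lee_fin -!prE // le_measure ?inE. Qed.

Let prDI A B : measurable A -> measurable B ->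
  pr A = pr (A `\` B) + pr (A `&` B).
Proof.
move=> mA mB; apply: EFin_inj; rewrite EFinD -!prE //.
- exact: measureDI.
- exact: measurableI.
- exact: measurableD.
Qed.

Lemma measurable_choice s f : measurable [set w | F s w = f].
Proof.
rewrite -[X in measurable X]setTI; apply: (unifF.1 s measurableT [set f]).
case: f => [[a b] c]; rewrite (_ : [set _] = ([set a] `*` [set b]) `*` [set c]).
  by apply: measurableX => //; exact: measurableX.
by apply/seteqP; split=> [[[x y] z] [-> -> ->] //|[[x y] z] [[/= -> ->] ->]].
Qed.

Definition past (t : nat) (c : nat -> face) : set T :=
  [set w | forall s, (s < t)%N -> F s w = c s].

Lemma pastS t c f : past t.+1 (fun s => if s == t then f else c s) =
  past t c `&` [set w | F t w = f].
Proof.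
apply/seteqP; split=> w /=.
  move=> H; split; last by rewrite H //= eqxx.
  by move=> s st; rewrite H /= ?ltn_eqF // ltnW.
move=> [H Ht] s; rewrite ltnS leq_eqVlt => /predU1P[->|st]; first by rewrite eqxx.
by rewrite ltn_eqF // H.
Qed.

Lemma measurable_past t c : measurable (past t c).
Proof.
rewrite (_ : past t c = \bigcap_(s in [set s | (s < t)%N]) [set w | F s w = c s]) //.
by apply: bigcap_measurableType => s _; exact: measurable_choice.
Qed.

(** The network is a function of finitely many choices, and there are countably
many finite sequences of faces. *)
Lemma measurable_RAN (Q : set plane_graph) t : measurable [set w | Q (RAN F t w)].
Proof.
pose c0 (l : seq face) s := nth outer l s.
rewrite (_ : [set _ | _] =
    \bigcup_(l : seq face) (past t (c0 l) `&` [set w | Q (ran (c0 l) t)])).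
  apply: countable_bigcupT_measurable => [|l]; first exact: countableP.
  apply: measurableI; first exact: measurable_past.
  have [Ql|Ql] := pselect (Q (ran (c0 l) t)).
    by rewrite (_ : [set _ | _] = setT) //; apply/seteqP; split.
  by rewrite (_ : [set _ | _] = set0) //; apply/seteqP; split.
apply/seteqP; split=> [w /= Qw|w [l _ [/= pl Ql]]].
  exists (mkseq (F^~ w) t) => //=.
  have pw : past t (c0 (mkseq (F^~ w) t)) w by move=> s st; rewrite /c0 nth_mkseq.
  by split=> //; rewrite -(eq_ran pw).
by rewrite /RAN (eq_ran (c' := c0 l)).
Qed.

Lemma pr_split (fs : seq face) t X : uniq fs -> measurable X ->
  pr X = \sum_(f <- fs) pr (X `&` [set w | F t w = f]) +
         pr (X `&` [set w | F t w \notin fs]).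
Proof.
move=> + mX; elim: fs => [_|f fs IHfs /= /andP[f_fs ufs]].
  rewrite big_nil add0r; congr pr; apply/seteqP; split=> w //=; by case.
have mfs (l : seq face) : measurable [set w | F t w \notin l].
  elim: l => [|g l IHl].
    by rewrite (_ : [set _ | _] = setT) //; apply/seteqP; split.
  rewrite (_ : [set _ | _] = ~` [set w | F t w = g] `&` [set w | F t w \notin l]).
    by apply: measurableI => //; apply: measurableC; exact: measurable_choice.
  apply/seteqP; split=> w /=; rewrite in_cons negb_or.
    by move=> /andP[/eqP].
  by move=> [/eqP-> ->].
suff E : pr (X `&` [set w | F t w \notin fs]) =
    pr (X `&` [set w | F t w = f]) + pr (X `&` [set w | F t w \notin f :: fs]).
  by rewrite IHfs // big_cons E; ring.
rewrite (prDI (B := [set w | F t w = f])); last exact: measurable_choice.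
  rewrite addrC; congr (pr _ + pr _); apply/seteqP; split=> w /=.
  - by move=> [[? _] ?].
  - by move=> [? Ff]; rewrite Ff.
  - by move=> [[? ?] /eqP ?]; rewrite in_cons negb_or; split=> //; apply/andP.
  - by move=> []; rewrite in_cons negb_or => ? /andP[/eqP].
exact: measurableI.
Qed.

Lemma pr_choice t c T0 f : models (ran c t) T0 -> f \in bfaces (ran c t) ->
  pr (past t c `&` [set w | F t w = f]) = (weight R (erase T0))^-1 * pr (past t c).
Proof.
move=> mod fb; apply: EFin_inj; rewrite EFinM -!prE; last 2 first.
- exact: measurable_past.
- by apply: measurableI; [exact: measurable_past|exact: measurable_choice].
rewrite (unifF.2 t c f fb) /weight -(size_faces_of outer).
by case: (mod) => _ _ /perm_size ->.
Qed.

(** By induction on the number of remaining steps. The next face is almost surely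
one of the current bounded faces, since their conditional probabilities add up
to 1; listing them in the order of the leaves turns the conditional expectation
into [step]. *)
Lemma pr_past_le (Q : set plane_graph) (h : shape -> R) :
  (forall x, 0 <= h x) ->
  (forall G T0, models G T0 -> Q G -> 1 <= h (erase T0)) ->
  forall m t c T0, models (ran c t) T0 ->
  pr (past t c `&` [set w | Q (RAN F (t + m) w)]) <=
    iter m (@step R) h (erase T0) * pr (past t c).
Proof.
move=> h0 hQ; elim=> [|m IHm] t c T0 mod.
  rewrite addn0 /=; have [Q1|Q0] := pselect (Q (ran c t)).
    rewrite -[leLHS]mul1r; apply: ler_pM => //; first exact: hQ Q1.
    apply: prS => //; last exact: measurable_past.
    by apply: measurableI; [exact: measurable_past|exact: measurable_RAN].
  rewrite [X in pr X](_ : _ = set0) ?pr0 ?mulr_ge0 //.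
  by apply/seteqP; split=> // w [/= pw]; rewrite /RAN (eq_ran pw).
have mp := measurable_past t c.
have mQ : measurable (past t c `&` [set w | Q (RAN F (t + m.+1) w)]).
  by apply: measurableI => //; exact: measurable_RAN.
have ub := models_uniq_faces mod; set fs := bfaces (ran c t) in ub.
have fsE : \sum_(f <- fs) (weight R (erase T0))^-1 = 1.
  rewrite big_const_seq count_predT iter_addr_0 /weight -(size_faces_of outer).
  case: (mod) => _ _ /perm_size <-.
  rewrite -[_ *+ _]mulr_natr mulVf // pnatr_eq0.
  by case: (mod) => _ _ /perm_size ->; rewrite size_faces_of.
have none : pr (past t c `&` [set w | F t w \notin fs]) = 0.
  have := pr_split t ub mp.
  rewrite (eq_big_seq (fun=> (weight R (erase T0))^-1 * pr (past t c))).
    by rewrite -mulr_suml fsE mul1r => /eqP; rewrite addrC -subr_eq subrr eq_sym => /eqP.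
  by move=> f fb; rewrite (pr_choice mod fb).
rewrite (pr_split t ub mQ).
have mnot : measurable [set w | F t w \notin fs].
  have -> : [set w | F t w \notin fs] =
      \bigcap_(f in [set` fs]) ~` [set w | F t w = f].
    apply/seteqP; split=> w /=; first by move=> /negP wf f ffs Ff; apply: wf; rewrite Ff.
    by move=> H; apply/negP => Ffs; exact: (H _ Ffs).
  apply: fin_bigcap_measurable => [|f _]; first exact: finite_seq.
  by apply: measurableC; exact: measurable_choice.
have -> : pr ((past t c `&` [set w | Q (RAN F (t + m.+1) w)]) `&`
    [set w | F t w \notin fs]) = 0.
  apply: le_anti; rewrite pr_ge0 andbT -none; apply: prS.
  - exact: measurableI.
  - exact: measurableI.
  - by move=> w [[? _] ?].
rewrite addr0 iterS [step _ _]/avg size_growths.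
case: (mod) => _ _ F0.
rewrite /fs (perm_big _ F0) /= -(lgrowths_faces (nvert (ran c t))) big_map.
rewrite -(lgrowths_erase (nvert (ran c t)) outer) big_map -mulrA mulr_suml.
rewrite big_seq [leRHS]big_seq; apply: ler_sum => -[f T'] pT.
have fb : f \in bfaces (ran c t).
  by rewrite (perm_mem F0) -(lgrowths_faces (nvert (ran c t))) (map_f (@fst _ _) pT).
rewrite -(pr_choice mod fb) -pastS.
have := IHm t.+1 (fun s => if s == t then f else c s) T'.
rewrite addSnnS; set c' := fun s => _.
have cc : ran c' t = ran c t.
  by apply: eq_ran => s st; rewrite /c' ltn_eqF.
have -> : past t c `&` [set w | Q (RAN F (t + m.+1) w)] `&` [set w | F t w = f] =
   past t.+1 c' `&` [set w | Q (RAN F (t + m.+1) w)] by rewrite pastS setIAC.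
by apply; rewrite /= cc /c' eqxx; exact: (models_insert mod pT).
Qed.

Lemma pr_le_mean (Q : set plane_graph) (h : shape -> R) t :
  (forall x, 0 <= h x) ->
  (forall G T0, models G T0 -> Q G -> 1 <= h (erase T0)) ->
  fine (P [set w | Q (RAN F t w)]) <= mean t h.
Proof.
move=> h0 hQ; rewrite mean_iter.
have := @pr_past_le Q h h0 hQ t 0%N (fun=> outer) lleaf models_triangle.
have -> : past 0 (fun=> outer) = setT by apply/seteqP; split.
by rewrite setTI add0n /= /pr probability_setT mulr1.
Qed.

(** Markov's inequality for [kept k]. *)
Lemma pr_longest_path k t (b : R) : 3 + (9 ^ k)%:R < b ->
  fine (P [set w | b <= (longest_path (RAN F t w))%:R]) <=
    (1 - thin_rate R) ^+ k * (2 * t).+1%:R / (b - 3 - (9 ^ k)%:R).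
Proof.
move=> kb; set D := b - 3 - _; have D0 : 0 < D by rewrite /D; lra.
have := @pr_le_mean (fun G => b <= (longest_path G)%:R)
  (fun x => D^-1 * (kept k x)%:R) t.
move=> /(_ _ _)/le_trans; apply.
- by move=> x; rewrite mulr_ge0 // invr_ge0 ltW.
- move=> G T0 mod bG; rewrite mulrC ler_pdivlMr // mul1r /D.
  have := longest_path_kept k mod; rewrite -(ltr_nat R) !natrD; lra.
- by rewrite meanZ mulrC ler_pM2r ?invr_gt0 //; exact: mean_kept.
Qed.

End Law.

(** * Almost sure convergence *)

(** The bad event [B i] concerns the times before [m i]. The random time is the
supremum of [t0] and of the numbers t0 + m i for which [B i] holds; by
Borel-Cantelli almost surely only finitely many of them do. *)
Lemma occurs_eventually_of_summable (R : realType) (d : measure_display)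
    (T : measurableType d) (P : probability T R) (A : nat -> set T)
    (B : nat -> set T) (m : nat -> nat) (t0 : nat) :
  {homo m : i j / (i <= j)%N} ->
  (forall i, measurable (B i)) ->
  (\sum_(i <oo) P (B i) < +oo)%E ->
  (forall w t, (t0 <= t)%N -> (forall i, (t < m i)%N -> ~ B i w) -> A t w) ->
  occurs_eventually P A.
Proof.
move=> m_homo mB sumB badA.
pose u i w : \bar R := ((m i)%:R * \1_(B i) w + t0%:R)%:E.
have u_t0 i w : ~ B i w -> u i w = t0%:R%:E.
  by move=> Bw; rewrite /u indicE memNset // mulr0 add0r.
have u_m i w : B i w -> u i w = ((m i)%:R + t0%:R)%:E.
  by move=> Bw; rewrite /u indicE mem_set // mulr1.
exists (fun w => esups (u ^~ w) 0); split.
- apply: measurable_fun_esups => i; apply/measurable_EFinP.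
  apply: measurable_funD => //; apply: measurable_funM => //.
- exists (lim_sup_set B); split.
  + apply: bigcap_measurableType => n _; exact: bigcup_measurable.
  + exact: lim_sup_set_cvg0.
  + move=> w /= Nw; apply: contrapT => Bw; apply: Nw.
    have [n nB] : exists n, forall i, (n <= i)%N -> ~ B i w.
      apply: contrapT => H; apply: Bw => n _; apply: contrapT => H'; apply: H.
      by exists n => i ni Bi; apply: H'; exists i.
    have u_ge i : (t0%:R%:E <= u i w)%E.
      by rewrite lee_fin lerDr mulr_ge0.
    rewrite fin_real //; apply/andP; split.
      apply: (@lt_le_trans _ _ (u 0%N w)); first by rewrite ltNyr.
      by apply: ereal_sup_ubound; exists 0%N.
    apply: (@le_lt_trans _ _ ((m n)%:R + t0%:R)%:E); last by rewrite ltry.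
    apply: ub_ereal_sup => _ [i _ <-].
    have [Bi|/u_t0->] := pselect (B i w); last by rewrite lee_fin lerDr.
    rewrite u_m //.
    rewrite lee_fin lerD2r ler_nat.
    have [ni|ni] := leqP n i; last exact: m_homo (ltnW ni).
    by case: (nB i ni).
- move=> w t Nt.
  have ut i : (u i w <= t%:R%:E)%E.
    by apply: le_trans Nt; apply: ereal_sup_ubound; exists i.
  apply: badA => [|i mt Bi].
    have := ut 0%N; have [/u_m->|/u_t0->] := pselect (B 0%N w).
      by rewrite lee_fin -natrD ler_nat; lia.
    by rewrite lee_fin ler_nat.
  have := ut i; rewrite (u_m _ _ Bi) lee_fin -natrD ler_nat; lia.
Qed.

Lemma nneseries_geometric_lty (R : realType) (a z : R) : 0 <= z < 1 ->
  (\sum_(i <oo) (a * z ^+ i)%:E < +oo)%E.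
Proof.
move=> /andP[z0 z1]; have zN : `|z| < 1 by rewrite ger0_norm.
have cv := @is_cvg_geometric_series _ a _ zN.
rewrite (_ : (fun n => _) = EFin \o series (geometric a z)); last first.
  by apply/funext => n; rewrite /= sumEFin.
by rewrite EFin_lim // ltry.
Qed.

Section Constants.
Variable R : realType.
Let eta : R := 4%:R * 10%:R ^- 8.
Let delta : R := 1 - eta.
Let c : R := 81 `^ delta.

Let c_gt0 : 0 < c. Proof. exact: powR_gt0. Qed.

(** The gain 10^-6 of one stage exceeds (1 - delta) ln 81, as ln 81 <= 8. *)
Let ratio_lt1 : (1 - thin_rate R) * 81 / c < 1.
Proof.
have -> : (1 - thin_rate R) * 81 / c = (1 - thin_rate R) * 81 `^ eta.
  by rewrite /c /delta powRB ?powRr1 //; [field; rewrite ?gt_eqF ?powR_gt0 | apply/implyP].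
have ln81 : ln (81 : R) <= 8.
  rewrite (_ : 81 = (1 + 2) ^+ 4) ?lnXn; [|lra|ring].
  have := @le_ln1Dx R 2; rewrite -mulr_natr; lra.
rewrite /powR gt_eqF //.
apply: (@le_lt_trans _ _ (expR (- thin_rate R) * expR (eta * ln 81))).
  by rewrite ler_pM2r ?expR_gt0 //; exact: expR_ge1Dx.
have etaE : eta = 4 / 100 * thin_rate R.
  rewrite /eta /thin_rate -[8%N]/(2 + 6)%N exprD invfM mulrA.
  by rewrite (_ : 10 ^- 2 = 100^-1 :> R) //; congr (_^-1); ring.
have rate0 : 0 < thin_rate R by rewrite invr_gt0 exprn_gt0.
rewrite -expRD -[ltRHS]expR0 ltr_expR etaE.
have := ler_wpM2l (ltW rate0) ln81.
move: (thin_rate R) (ln 81) rate0 => x y x0; lra.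
Qed.

Let c_ge : 27 <= c.
Proof.
have := ratio_lt1; rewrite ltr_pdivrMr // /thin_rate; lra.
Qed.


Lemma pow27_ge n : (6 + 2 * 9 ^ n.+1 <= 27 ^ n.+1)%N.
Proof. by elim: n => // n IHn; rewrite expnS [(27 ^ _)%N]expnS; lia. Qed.

(** With n = i + 1 stages at time 81^(n+1), the denominator in [pr_longest_path]
is at least half of 81^(n delta), because 81^delta >= 27. *)
Lemma bad_scale_summable (d : measure_display)
    (T : measurableType d) (P : probability T R) (F : nat -> T -> face) :
  uniform_face_choices P F ->
  (\sum_(i <oo) P [set w | ((81 ^ i.+1)%:R `^ delta <=
      (longest_path (RAN F (81 ^ i.+2)%N w))%:R)%R] < +oo)%E.
Proof.
move=> unifF.
pose theta := (1 - thin_rate R) * 81 / c.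
have rate1 : 0 < 1 - thin_rate R by rewrite /thin_rate; lra.
have theta0 : 0 <= theta by rewrite /theta divr_ge0 ?mulr_ge0 ?ltW.
have th : 0 <= theta < 1 by rewrite theta0 ratio_lt1.
apply: le_lt_trans (nneseries_geometric_lty (486 * theta) th).
apply: lee_nneseries => [i _ _|i _]; first exact: measure_ge0.
set B := [set w | _].
have mB : measurable B.
  exact: (measurable_RAN unifF (fun G => (81 ^ i.+1)%:R `^ delta <= (longest_path G)%:R)).
rewrite -[leLHS]fineK ?fin_num_measure // lee_fin.
have bE : (81 ^ i.+1)%:R `^ delta = c ^+ i.+1.
  by rewrite natrX -powR_mulrn // -powRrM mulrC powRrM powR_mulrn // ltW.
have b27 : (27 ^ i.+1)%:R <= c ^+ i.+1.
  by rewrite natrX ler_pXn2r ?nnegrE // ltW.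
have := pow27_ge i; rewrite -(ler_nat R) natrD natrM => b9.
have b0 : 0 < c ^+ i.+1 by exact: exprn_gt0.
have n0 : 0 <= (9 ^ i.+1)%:R :> R by exact: ler0n.
have hb : 3 + (9 ^ i.+1)%:R < (81 ^ i.+1)%:R `^ delta by rewrite bE; lra.
apply: le_trans (pr_longest_path unifF (81 ^ i.+2) hb) _; rewrite bE.
rewrite ler_pdivrMr; last by rewrite bE in hb; lra.
apply: (@le_trans _ _ ((1 - thin_rate R) ^+ i.+1 * (243 * 81 ^+ i.+1))).
  rewrite ler_pM2l ?exprn_gt0 // -natrX.
  rewrite -[243]/(243%:R) -natrM ler_nat.
  by rewrite [(81 ^ i.+2)%N]expnS mulnA ltn_pmul2r ?expn_gt0.
apply: (@le_trans _ _ (486 * theta * theta ^+ i * (c ^+ i.+1 / 2))).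
  have -> : 486 * theta * theta ^+ i = 486 * theta ^+ i.+1 by rewrite exprS mulrA.
  rewrite /theta !exprMn exprVn le_eqVlt; apply/orP; left; apply/eqP.
  by field; rewrite gt_eqF.
apply: ler_wpM2l; last by lra.
have K0 : 0 <= 486 :> R by exact: ler0n.
exact: mulr_ge0 (mulr_ge0 K0 theta0) (exprn_ge0 _ theta0).
Qed.

End Constants.

Theorem mainTheorem4 (R : realType) (d : measure_display)
    (T : measurableType d) (P : probability T R) (F : nat -> T -> face)
    (unifF : uniform_face_choices P F) :
  let delta : R := 1 - 4%:R * 10%:R ^- 8 in
  occurs_eventually P
    (fun t => [set w | (longest_path (RAN F t w))%:R < t%:R `^ delta]).
Proof.
move=> delta.
pose B i := [set w | (81 ^ i.+1)%:R `^ delta <=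
  (longest_path (RAN F (81 ^ i.+2)%N w))%:R].
apply: (@occurs_eventually_of_summable _ _ _ _ _ B (fun i => 81 ^ i.+2)%N 81).
- by move=> i j ij; rewrite leq_pexp2l.
- move=> i.
  exact: (measurable_RAN unifF (fun G => (81 ^ i.+1)%:R `^ delta <= (longest_path G)%:R)).
- exact: bad_scale_summable unifF.
move=> w t t81 noB /=.
have t0 : (0 < t)%N by exact: leq_trans t81.
have /andP[lo hi] := trunc_log_bounds (isT : (1 < 81)%N) t0.
have : (0 < trunc_log 81 t)%N by exact: trunc_log_max.
case: (trunc_log 81 t) lo hi => // i lo hi _.
have /negP := noB i hi; rewrite -ltNge => Lt.
apply: (@le_lt_trans _ _ (longest_path (RAN F (81 ^ i.+2) w))%:R).
  by rewrite ler_nat longest_path_ran // ltnW.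
apply: lt_le_trans Lt _; apply: ge0_ler_powR; rewrite ?nnegrE ?ler_nat //.
rewrite /delta subr_ge0 /eta ler_pdivrMr ?exprn_gt0 // mul1r.
by apply: (@le_trans _ _ 10); [lra | apply: ler_eXnr => //; lra].
Qed.
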